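(* Let $(\mathbb{Y},\mathscr{Y})$ be a measurable space and let $g:(0,\infty)\to\mathbb{R}$ be a convex function with $g(1)=0$, with associated $g$-divergence $D_g$. For a probability measure $P$ on $\mathscr{Y}$ and a loss function $h$ on $\mathbb{Y}$, let $P_h$ denote the conditional distribution determined by $P$, $h$ and $D_g$ (the unique minimizer of $\lambda\mapsto\int_{\mathbb{Y}}h\,\mathrm{d}\lambda+D_g(\lambda,P)$ over probability measures $\lambda\ll P$ on $\mathscr{Y}$), whenever it is properly defined. Assume that for every probability measure $P$ on $\mathscr{Y}$ and for every choice of loss functions $h_I$ and $h_J$ on $\mathbb{Y}$ such that, with $h_{IJ}:=h_I+h_J$, the measures $\bar P:=P_{h_I}$, $P_{h_{IJ}}$ and $\bar P_{h_J}$ are all properly defined, one has $$P_{h_{IJ}}=\bar P_{h_J}.$$ Then $D_g$ is the Kullback--Leibler divergence up to a positive multiplicative constant; that is, there exists a constant $k>0$ such that $$D_g(Q_1,Q_2)=k\int_{\mathbb{Y}}\ln\left(\frac{\mathrm{d}Q_1}{\mathrm{d}Q_2}\right)\mathrm{d}Q_1$$ for every pair $(Q_1,Q_2)$ of probability measures on $\mathscr{Y}$ with $Q_1\ll Q_2$.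
   Context: **$g$-divergence.** For a convex function $g:(0,\infty)\to\mathbb{R}$ with $g(1)=0$ and probability measures $Q_1\ll Q_2$ on $\mathscr{Y}$, $$D_g(Q_1,Q_2)=\int_{\mathbb{Y}} g\left(\frac{\mathrm{d}Q_1}{\mathrm{d}Q_2}\right)\mathrm{d}Q_2\in[0,+\infty],$$ with the convention $g(0):=\lim_{x\to0^+}g(x)\in(-\infty,+\infty]$. The Kullback--Leibler divergence is $D(Q_1,Q_2)=\int\ln\left(\frac{\mathrm{d}Q_1}{\mathrm{d}Q_2}\right)\mathrm{d}Q_1$, which corresponds to $g(x)=x\ln x$. **Loss functions.** A loss function is a measurable function $h:\mathbb{Y}\to(-\infty,+\infty]$. Here $h_I$ and $h_J$ represent the losses attached to two non-overlapping pieces of information $I$ and $J$, and the combined information $IJ$ has loss $h_{IJ}(y)=h_I(y)+h_J(y)$ for all $y\in\mathbb{Y}$. **Conditional distribution.** Given a probability measure $P$ on $\mathscr{Y}$ and a loss function $h$, consider the cumulative loss $$L(\lambda)=\int_{\mathbb{Y}}h(y)\,\lambda(\mathrm{d}y)+D_g(\lambda,P)$$ on the class of probability measures $\lambda$ on $\mathscr{Y}$ that are absolutely continuous with respect to $P$ (only those $\lambda$ for which $L(\lambda)$ is well defined as an extended real number are considered). If there is a unique probability measure in this class minimizing $L$, it is denoted $P_h$ and one says that $P_h$ is properly defined; otherwise $P_h$ is not properly defined. The measure $\bar P_{h_J}$ is obtained by the same definition with $P$ replaced by $\bar P=P_{h_I}$, that is, by minimizing $\int h_J\,\mathrm{d}\lambda+D_g(\lambda,\bar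 P)$ over probability measures $\lambda\ll\bar P$. *)

(* Defs.v *)
From mathcomp Require Import all_boot all_order all_algebra.
From mathcomp Require Import all_classical all_reals all_analysis.
From mathcomp Require Import measurable_realfun giry.
Import Order.TTheory GRing.Theory Num.Theory.
Import numFieldNormedType.Exports.

Set Implicit Arguments.
Unset Strict Implicit.
Unset Printing Implicit Defensive.

Local Open Scope classical_set_scope.
Local Open Scope ring_scope.
Local Open Scope charge_scope.
Local Open Scope ereal_scope.

Section defs.
Context d (T : measurableType d) (R : realType).
Implicit Types (P Q mu : probability T R) (h : T -> \bar R) (g : R -> R).

Definition density Q P : T -> \bar R :=
  'd (charge_of_finite_measure Q) '/d P.

(* Only the values of g on ]0, +oo[ matter; g is extended to 0 by its limit at
   0+. A version of the density is negative only on a null set, so the value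
   given to negative arguments is immaterial. *)
Definition ext0 g (r : R) : \bar R :=
  if (0 < r)%R then (g r)%:E else lim ((g x)%:E @[x --> 0%R^'+]).

(* Meant for Q `<< P. The density is then real-valued, and the integral is well
   defined, as a convex function is bounded below by an affine one. *)
Definition gdivergence g Q P : \bar R :=
  \int[P]_y ext0 g (fine (density Q P y)).

(* lne is -oo at 0; the density is positive Q-almost everywhere. *)
Definition KL Q P : \bar R := \int[Q]_y lne (density Q P y).

Definition loss_function h := measurable_fun [set: T] h /\ forall y, -oo < h y.

Definition cumulative_loss g P h mu : \bar R :=
  \int[mu]_y h y + gdivergence g mu P.

(* The library gives a value to every integral and every sum in \bar R, so the
   absence of +oo - oo, in the integral of h or in the sum, is required
   explicitly. *)
Definition cumulative_loss_defined g P h mu : bool :=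
  (\int[mu]_y (h^\+ y) +? - \int[mu]_y (h^\- y)) &&
  (\int[mu]_y h y +? gdivergence g mu P).

Definition admissible g P h mu : Prop :=
  mu `<< P /\ cumulative_loss_defined g P h mu.

Definition minimizer g P h mu : Prop :=
  admissible g P h mu /\
  forall nu : probability T R, admissible g P h nu ->
    cumulative_loss g P h mu <= cumulative_loss g P h nu.

(* P_h is properly defined and equal to Q. As library measures are functions on
   all subsets of T, uniqueness is up to agreement on the measurable sets. *)
Definition conditional_distribution g P h Q : Prop :=
  minimizer g P h Q /\ forall mu, minimizer g P h mu -> measure_eq mu Q.

End defs.

(* Main.v *)
Require Import Defs.
From HB Require Import structures.
From mathcomp Require Import all_boot all_order all_algebra.
From mathcomp Require Import all_classical all_reals all_analysis.
From mathcomp Require Import measurable_realfun giry.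
From mathcomp Require Import ring lra.
Import Order.TTheory GRing.Theory Num.Theory.
Import numFieldNormedType.Exports.

Local Open Scope classical_set_scope.
Local Open Scope ring_scope.

(** If no measurable set separates two points, all densities are equal to 1 and
    both divergences vanish ([trivial_sigma_algebra_divergence]).  Otherwise fix a
    measurable [A] with [a] in [A] and [b] outside: the measures
    [p delta_a + (1 - p) delta_b] and the losses [h 1_A] already determine [g].
    A measure dominated by such a two-point measure is again of this form, so
    conditioning becomes the minimization over [l] in [0, 1] of [D_p l + h l],
    where [D_p l = p g(l/p) + (1-p) g((1-l)/(1-p))] ([strict_min_conditional]).

    Convexity is used through subgradients.  The measure [delta_b] cannot be
    updated any more; if some loss led to it from [p = 1/2], the opposite loss
    would have to lead to it as well, although symmetry makes it lead to
    [delta_a].  Hence the slopes of [g] are unbounded below near 0 ([steep]), and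
    for every loss [h] outside a countable set the minimizer exists, is unique
    and lies in ]0, 1[ ([ex_exposed]).

    If [l] is the unique minimizer for [p] at slope [v = - h], coherence says that
    [D_l] has the slope [w] at the same points where [D_p] has the slope [v + w]
    ([subgrad_shift]).  A kink of [D_p] at [l] would provide an interval of such
    [v], and the subdifferential of [D_l] at [l] would be invariant under
    translations, which is absurd ([binary_div_slope_unique]).  So [g] has a single
    slope [phi x] at each [x], and the slope
    [G_p m = phi (m/p) - phi ((1-m)/(1-p))] of [D_p] satisfies the cocycle identity
    [G_p m = G_p l + G_l m] ([binary_div_slope_cocycle]).

    For [l = p x], [m = p z] and [p] tending to 0 the terms involving
    [1 - l], [1 - m] and [1 - p] all tend to [phi 1], and what remains is
    [phi z = phi x + phi (z/x) - phi 1] ([strict_additive]).  This holds when [phi]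
    takes the value [phi x] only at [x]; such values are dense, and monotonicity
    extends the equation to all [x] ([phi_mul]).  Therefore [phi = c + k ln], and
    [g x = k (x ln x - x + 1) + c (x - 1)]; the terms in [x - 1] integrate to 0
    against every density, which leaves [k] times the Kullback-Leibler divergence
    ([gdivergence_klfun]). *)

(** * Subgradients *)

Definition subgrad {R : realType} (I : set R) (f : R -> R) (x v : R) :=
  I x /\ forall y, I y -> f x + v * (y - x) <= f y.

Lemma subgrad_le {R : realType} {I : set R} {f : R -> R} {x y v w : R} :
  subgrad I f x v -> subgrad I f y w -> v < w -> x <= y.
Proof. by move=> [Ix /(_ y) + [Iy /(_ x)]] => /(_ Iy) + /(_ Ix); nra. Qed.

Lemma subgrad_slope_le {R : realType} {I : set R} {f : R -> R} {x y v w : R} :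
  subgrad I f x v -> subgrad I f y w -> x < y -> v <= w.
Proof.
move=> sx sy xy; case: (leP v w) => // /(subgrad_le sy sx).
by rewrite leNgt xy.
Qed.

(** The slopes [v] for which [f x - v * x] has more than one minimizer. *)
Definition flat_slopes {R : realType} (I : set R) (f : R -> R) : set R :=
  [set v | exists x y, [/\ x < y, subgrad I f x v & subgrad I f y v]].

(** Between two minimizers for one slope there is none for another slope, by
    [subgrad_le], so the intervals that belong to distinct flat slopes are disjoint,
    and a rational number in each of them enumerates the slopes. *)
Lemma countable_flat_slopes {R : realType} (I : set R) (f : R -> R) :
  countable (flat_slopes I f).
Proof.
pose F (q : rat) := [set v : R | exists x y,
  [/\ x < ratr q < y, subgrad I f x v & subgrad I f y v]].
apply: (@sub_countable _ _ _ (\bigcup_(q in setT) F q)).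
  apply: subset_card_le => v [x [y [xy sx sy]]].
  have [q] := rat_in_itvoo xy.
  by rewrite in_itv /= => hq; exists q => //; exists x, y.
apply: bigcup_countable => // q _.
have ub v w : F q v -> F q w -> v < w -> False.
  move=> [x [y [/andP[xq qy] sx sy]]] [x' [y' [/andP[xq' qy'] sx' sy']]] vw.
  by have := subgrad_le sy sx' vw; lra.
have [[v Fv]|nF] := pselect (F q !=set0); last first.
  by apply: sub_countable (countable0 R); apply: subset_card_le => v Fv; case: nF; exists v.
apply: sub_countable (countable1 v); apply: subset_card_le => w Fw /=.
by case: (ltgtP v w) => // vw; [case: (ub _ _ Fv Fw)|case: (ub _ _ Fw Fv)].
Qed.

Lemma ex_notin_countable {R : realType} (C : set R) (a b : R) :
  countable C -> a < b -> exists2 v, a < v < b & ~ C v.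
Proof.
move=> cC ab; apply: contrapT => nex.
have sub : `]a, b[ `<=` C.
  move=> v /=; rewrite in_itv /= => vab; apply: contrapT => nC.
  by apply: nex; exists v.
have := countable_lebesgue_measure0 (sub_countable (subset_card_le sub) cC).
rewrite lebesgue_measure_itv /= lte_fin ab -EFinD => /eqP.
by rewrite eqe subr_eq0; move: ab => /[swap] /eqP ->; rewrite ltxx.
Qed.

(** An intermediate value theorem for the subdifferential: the supremum of the
    points having a slope at most [v] has the slope [v] itself. *)
Lemma ex_subgrad_between {R : realType} {I : set R} {f : R -> R} {a b s t v : R} :
  is_interval I -> (forall x, I x -> exists r, subgrad I f x r) ->
  subgrad I f a s -> subgrad I f b t -> s < v < t ->
  exists2 x, a <= x <= b & subgrad I f x v.
Proof.
move=> II exs sa sb /andP[sv vt].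
pose S := [set y | exists2 r, r <= v & subgrad I f y r].
have Sa : S a by exists s => //; exact: ltW.
have ubb : ubound S b.
  by move=> y [r rv sy]; apply: subgrad_le sy sb _; exact: le_lt_trans vt.
have hS : has_sup S by split; [exists a|exists b].
have ax : a <= sup S by exact: sup_upper_bound.
have xb : sup S <= b by apply: ge_sup => //; exists a.
have Ix : I (sup S) by apply: II _ _ sa.1 sb.1 _ _; rewrite ax xb.
exists (sup S); rewrite ?ax//; set x := sup S in ax xb Ix *.
have toS y : I y -> x < y -> exists2 u, v < u & subgrad I f y u.
  move=> Iy xy; have [u su] := exs y Iy; exists u => //.
  rewrite ltNge; apply/negP => uv.
  suff : y <= x by rewrite leNgt xy.
  by apply: sup_upper_bound => //; exists u.
(* Just to the right of x all slopes exceed v; the bound at x follows by letting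
   a point y of ]x, z[ tend to x. *)
have rgtP z r : subgrad I f x r -> r < v -> I z -> x < z ->
    f x + v * (z - x) <= f z.
  move=> sx rv Iz xz; apply/ler_addgt0Pl => e e0.
  pose y := Num.min ((x + z) / 2) (x + e / (v - r)).
  have vr : 0 < v - r by rewrite subr_gt0.
  have yx : x < y by rewrite lt_min ltrDl divr_gt0 ?subr_gt0 ?andbT//; lra.
  have yz : y < z by rewrite gt_min; apply/orP; left; lra.
  have ye : (v - r) * (y - x) <= e.
    by rewrite mulrC -ler_pdivlMr// lerBlDl ge_min lexx orbT.
  have Iy : I y by apply: II _ _ Ix Iz _ _; rewrite (ltW yx) ltW.
  have [u vu [_ /(_ z Iz) h1]] := toS y Iy yx.
  have h2 := sx.2 y Iy.
  nra.
(* Symmetrically, points y < x with a slope at most v accumulate at x, as x is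
   not one of them. *)
have lftP z r : subgrad I f x r -> v < r -> ~ S x -> I z -> z < x ->
    f x + v * (z - x) <= f z.
  move=> sx rv nSx Iz zx; apply/ler_addgt0Pl => e e0.
  have vr : 0 < r - v by rewrite subr_gt0.
  have e1 : 0 < Num.min (x - z) (e / (r - v)).
    by rewrite lt_min subr_gt0 zx divr_gt0.
  have [y Sy] := sup_adherent e1 hS.
  rewrite -/x ltrBlDr -ltrBlDl lt_min => /andP[h1 h2].
  have yx : y <= x by exact: sup_upper_bound.
  case: Sy => u uv [Iy /(_ z Iz) h3].
  have h4 := sx.2 y Iy.
  have : (r - v) * (x - y) <= e by rewrite mulrC -ler_pdivlMr// ltW.
  nra.
split=> // z Iz; have [r0 sr0] := exs x Ix.
have [[r rv sr]|nSx] := pselect (S x).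
  case: (ltgtP x z) => [xz|zx|->]; last by rewrite subrr mulr0 addr0.
    move: rv; rewrite le_eqVlt => /predU1P[<-|rv]; first exact: sr.2.
    exact: rgtP sr rv Iz xz.
  by have := sr.2 z Iz; nra.
have vr0 : v < r0.
  by rewrite ltNge; apply/negP => r0v; apply: nSx; exists r0.
case: (ltgtP x z) => [xz|zx|->]; last by rewrite subrr mulr0 addr0.
  by have := sr0.2 z Iz; nra.
exact: lftP sr0 vr0 nSx Iz zx.
Qed.

Definition posreals {R : realType} : set R := [set x | 0 < x].
Definition unit_itv {R : realType} : set R := [set x | 0 < x < 1].

Lemma convex_three_points {R : realType} {g : R -> R} {x y z : R} :
  convex_function (`]0, +oo[ : set R) g -> 0 < x -> x < y -> y < z ->
  (g y - g x) * (z - y) <= (g z - g y) * (y - x).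
Proof.
move=> cg x0 xy yz; have zx : 0 < z - x by lra.
pose t := (z - y) / (z - x).
have t0 : 0 <= t by apply: divr_ge0; lra.
have t1 : t <= 1 by rewrite ler_pdivrMr// mul1r; lra.
have := @cg (Itv01 t0 t1) x z.
rewrite !inE /= !in_itv /= !andbT => /(_ x0 (lt_trans x0 (lt_trans xy yz))).
rewrite -[X in is_true X]/(g (t * x + (1 - t) * z) <= t * g x + (1 - t) * g z).
have -> : t * x + (1 - t) * z = y by rewrite /t; field; rewrite gt_eqF.
move=> h; have {h} : g y * (z - x) <= (t * g x + (1 - t) * g z) * (z - x).
  by rewrite ler_pM2r.
have -> : (t * g x + (1 - t) * g z) * (z - x) = (z - y) * g x + (y - x) * g z.
  by rewrite /t; field; rewrite gt_eqF.
nra.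
Qed.

(** The supremum of the slopes of the chords on the left of [x], all of which are
    bounded by the slopes of the chords on its right. *)
Lemma convex_ex_subgrad {R : realType} (g : R -> R) :
  convex_function (`]0, +oo[ : set R) g ->
  forall x, posreals x -> exists s, subgrad posreals g x s.
Proof.
move=> cg x x0.
pose S := [set (g x - g w) / (x - w) | w in [set w | 0 < w < x]].
have ubS z : x < z -> ubound S ((g z - g x) / (z - x)).
  move=> xz _ [w /= /andP[w0 wx] <-].
  have := convex_three_points cg w0 wx xz.
  rewrite ler_pdivrMr ?subr_gt0// mulrAC ler_pdivlMr ?subr_gt0//.
have S0 : S !=set0.
  exists ((g x - g (x/2)) / (x - x/2)); exists (x / 2) => //=.
  by move: x0; rewrite /posreals /=; lra.
have hS : has_sup S by split=> //; exists ((g (x+1) - g x) / (x+1-x)); apply: ubS; lra.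
exists (sup S); split=> // y y0; case: (ltgtP x y) => [xy|yx|->]; last 1 first.
- by rewrite subrr mulr0 addr0.
- have : sup S <= (g y - g x) / (y - x) by apply: ge_sup => //; exact: ubS.
  by rewrite ler_pdivlMr ?subr_gt0//; lra.
- have : (g x - g y) / (x - y) <= sup S.
    by apply: sup_upper_bound => //; exists y => //=; rewrite yx andbT.
  by rewrite ler_pdivrMr ?subr_gt0//; lra.
Qed.

(** Subtracting a linear function with a slope of [g] at 1 makes [g]
    nonincreasing on ]0, 1[, so that the limit exists in the extended reals. *)
Lemma is_cvg_at_0 {R : realType} (g : R -> R) :
  (forall x, posreals x -> exists s, subgrad posreals g x s) ->
  cvg ((g x)%:E @[x --> 0%R^'+]).
Proof.
move=> exs; have [s1 sg1] := exs 1 ltr01.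
pose f x := (g x - s1 * x)%:E.
have nif : {in Interval (BRight 0) (BLeft 1) &, nonincreasing_fun f}.
  move=> x y; rewrite !in_itv /= => /andP[x0 x1] /andP[y0 y1] xy.
  rewrite /f lee_fin; have [sy sgy] := exs y y0.
  have := subgrad_slope_le sgy sg1 y1; have := sgy.2 x x0; nra.
have lt01 : (BRight (0:R) < BLeft 1)%O by rewrite bnd_simp.
have /cvg_ex[l fl] : cvg (f x @[x --> 0^'+]).
  by apply/cvg_ex; eexists; exact: (nonincreasing_at_right_cvge _ lt01 nif).
apply/cvg_ex; exists (l + 0)%E.
have -> : (fun x => (g x)%:E) = (f \+ (fun x => (s1 * x)%:E))%E.
  by apply/funext => x; rewrite /f /= -EFinD subrK.
apply: cvgeD => //; first by rewrite fin_num_adde_defl.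
apply: cvg_EFin; first by near=> x.
apply: cvg_at_right_filter.
rewrite -[X in _ --> X](mulr0 s1).
by apply: cvgM; [exact: cvg_cst|exact: cvg_id].
Unshelve. all: by end_near.
Qed.

Lemma ext0_pos {R : realType} (g : R -> R) (x : R) :
  0 < x -> ext0 g x = (g x)%:E.
Proof. by rewrite /ext0 => ->. Qed.

(** The supporting lines of [g] also bound its extension to 0, whose value may be
    infinite. *)
Lemma ext0_ge {R : realType} {g : R -> R} {x s y : R} :
  (forall x, posreals x -> exists s, subgrad posreals g x s) ->
  subgrad posreals g x s -> 0 <= y -> ((g x + s * (y - x))%:E <= ext0 g y)%E.
Proof.
move=> exs sx; rewrite le_eqVlt => /predU1P[<-|y0]; last first.
  by rewrite ext0_pos// lee_fin; exact: sx.2.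
rewrite /ext0 ltxx; apply/lee_subgt0Pr => e e0.
apply: lime_ge; first exact: is_cvg_at_0.
near=> z.
have z0 : 0 < z by near: z; exact: nbhs_right_gt.
have zs : s * z < e \/ s * z >= e by case: (ltP (s * z) e); [left|right].
rewrite -EFinB lee_fin; have := sx.2 z z0.
suff : - e <= s * z by lra.
have : z < e / (`|s| + 1).
  by near: z; apply: nbhs_right_lt; rewrite divr_gt0// ltr_wpDl.
rewrite ltr_pdivlMr ?ltr_wpDl// => h; have := ler_norm (- s).
by rewrite normrN; nra.
Unshelve. all: by end_near.
Qed.

Lemma ext0_le {R : realType} {g : R -> R} {K y : R} :
  (forall x, posreals x -> exists s, subgrad posreals g x s) ->
  (forall x s, subgrad posreals g x s -> - K <= s) ->
  0 < y -> (ext0 g 0 <= (g y + K * y)%:E)%E.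
Proof.
move=> exs hK y0; rewrite /ext0 ltxx.
apply/lee_addgt0Pr => e e0.
apply: lime_le; first exact: is_cvg_at_0.
near=> z.
have z0 : 0 < z by near: z; exact: nbhs_right_gt.
have zy : z < y by near: z; exact: nbhs_right_lt.
have ze : z < e / (`|K| + 1).
  by near: z; apply: nbhs_right_lt; rewrite divr_gt0// ltr_wpDl.
have [s sz] := exs z z0.
rewrite -EFinD lee_fin; have := sz.2 y y0; have := hK _ _ sz.
move: ze; rewrite ltr_pdivlMr ?ltr_wpDl//; have := ler_norm (- K); rewrite normrN.
nra.
Unshelve. all: by end_near.
Qed.

(** * The divergence between Bernoulli laws *)

(** The divergence of the Bernoulli law with mean [l] from that with mean [p],
    for means in ]0, 1[. *)
Definition binary_div {R : realType} (g : R -> R) (p l : R) : R :=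
  p * g (l / p) + (1 - p) * g ((1 - l) / (1 - p)).

(** The same divergence when [l] may also be 0 or 1. *)
Definition binary_div_ext {R : realType} (g : R -> R) (p l : R) : \bar R :=
  (p%:E * ext0 g (l / p) + (1 - p)%:E * ext0 g ((1 - l) / (1 - p)))%E.

(** In terms of means: the loss equal to [h] on success and to 0 on failure turns
    the Bernoulli law with mean [p] into the one with mean [l]. *)
Definition strict_min {R : realType} (g : R -> R) (p h l : R) : Prop :=
  0 <= l <= 1 /\ forall m, 0 <= m <= 1 -> m != l ->
    (binary_div_ext g p l + (h * l)%:E < binary_div_ext g p m + (h * m)%:E)%E.

(** What coherence says once the first piece of information has led to a Dirac
    mass. *)
Definition coherent_at_0 {R : realType} (g : R -> R) : Prop :=
  forall p h h' m, 0 < p < 1 ->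
  strict_min g p h 0 -> strict_min g p (h + h') m -> m = 0.

(** What coherence says as long as the first update keeps both outcomes
    possible. *)
Definition coherent_inside {R : realType} (g : R -> R) : Prop :=
  forall p l h h' m m', 0 < p < 1 -> 0 < l < 1 ->
  strict_min g p h l -> strict_min g l h' m -> strict_min g p (h + h') m' ->
  m' = m.

Lemma binary_div_extE {R : realType} (g : R -> R) (p l : R) :
  0 < p < 1 -> 0 < l < 1 -> binary_div_ext g p l = (binary_div g p l)%:E.
Proof.
move=> /andP[p0 p1] /andP[l0 l1].
by rewrite /binary_div_ext !ext0_pos ?divr_gt0 ?subr_gt0// -!EFinM -EFinD.
Qed.

Section binary_divergence.
Context {R : realType} {g : R -> R}.
Hypothesis exs : forall x, posreals x -> exists s, subgrad posreals g x s.
Local Notation U := (@unit_itv R).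
Local Notation pos := (@posreals R).

(** A slope of the binary divergence is a difference of slopes of [g]; only the
    slopes obtained in this way are known to be supporting up to the endpoints 0
    and 1. *)
Lemma binary_div_ext_ge {p l s r m : R} : 0 < p < 1 ->
  subgrad pos g (l / p) s -> subgrad pos g ((1 - l) / (1 - p)) r ->
  0 <= m <= 1 -> ((binary_div g p l + (s - r) * (m - l))%:E <= binary_div_ext g p m)%E.
Proof.
move=> /andP[p0 p1] sl sr /andP[m0 m1].
have q0 : 0 < 1 - p by rewrite subr_gt0.
have h1 := ext0_ge exs sl (divr_ge0 m0 (ltW p0)).
have m1q : 0 <= (1 - m) / (1 - p) by rewrite divr_ge0 ?subr_ge0// ltW.
have h2 := ext0_ge exs sr m1q.
rewrite /binary_div_ext.
have -> : binary_div g p l + (s - r) * (m - l) = p * (g (l / p) + s * (m / p - l / p))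
   + (1 - p) * (g ((1 - l) / (1 - p)) +
       r * ((1 - m) / (1 - p) - (1 - l) / (1 - p))).
  by rewrite /binary_div; field; rewrite !gt_eqF.
rewrite EFinD !EFinM; apply: leeD; apply: lee_wpmul2l => //; rewrite lee_fin; exact: ltW.
Qed.

Lemma subgrad_binary_div {p l s r : R} : 0 < p < 1 -> U l ->
  subgrad pos g (l / p) s -> subgrad pos g ((1 - l) / (1 - p)) r ->
  subgrad U (binary_div g p) l (s - r).
Proof.
move=> p01 Ul sl sr; split => // m Um.
rewrite -lee_fin -(binary_div_extE g p m p01 Um); apply: binary_div_ext_ge => //.
by case/andP: Um => ? ?; rewrite !ltW.
Qed.

Lemma ex_subgrad_binary_div p l : 0 < p < 1 -> U l ->
  exists s r, [/\ subgrad pos g (l / p) s, subgrad pos g ((1 - l) / (1 - p)) r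
    & subgrad U (binary_div g p) l (s - r)].
Proof.
move=> p01 Ul; have /andP[p0 p1] := p01; have /andP[l0 l1] := Ul.
have [s sl] := exs (l / p) (divr_gt0 l0 p0).
have [|r sr] := exs ((1 - l) / (1 - p)); first by rewrite /posreals/= divr_gt0 ?subr_gt0.
by exists s, r; split => //; exact: subgrad_binary_div.
Qed.

(** [l] is the only minimizer over ]0, 1[ for the loss [- v]. *)
Definition exposed p v l :=
  subgrad U (binary_div g p) l v /\ forall m, subgrad U (binary_div g p) m v -> m = l.

(** The minimum over ]0, 1[ is compared with a value at [m] in [0, 1] by means of a
    slope of the special form of [binary_div_ext_ge] at the midpoint of [l] and [m];
    uniqueness of the minimizer makes that slope different from [v]. *)
Lemma exposed_strict_min {p v l : R} :
  0 < p < 1 -> exposed p v l -> strict_min g p (- v) l.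
Proof.
move=> p01 [sl ul]; have /andP[l0 l1] := sl.1.
split=> [|m /andP[m0 m1] ml]; first by rewrite !ltW.
rewrite binary_div_extE//; last by rewrite l0.
have main l2 : U l2 -> (m - l2) * (l2 - l) > 0 ->
    ((binary_div g p l)%:E + (- v * l)%:E < binary_div_ext g p m + (- v * m)%:E)%E.
  move=> Ul2 pl.
  have [s [r [h1 h2 h3]]] := ex_subgrad_binary_div p l2 p01 Ul2.
  have m01 : 0 <= m <= 1 by rewrite m0.
  have h4 := binary_div_ext_ge p01 h1 h2 m01.
  apply: (@lt_le_trans _ _ ((binary_div g p l2 + (s - r) * (m - l2))%:E + (- v * m)%:E)%E); last first.
    exact: leeD.
  rewrite -!EFinD lte_fin.
  have h5 := sl.2 _ Ul2.
  have nv : s - r != v.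
    apply/eqP => e; move: pl; rewrite -e in ul.
    by rewrite (ul _ h3) subrr mulr0 ltxx.
  have : 0 < (s - r - v) * (m - l2).
    case: (ltgtP m l2) => [lt|lt|e]; last by move: pl; rewrite e subrr mul0r ltxx.
      have l2l : l2 < l by nra.
      have uv : s - r < v by rewrite lt_neqAle nv (subgrad_slope_le h3 sl).
      by rewrite nmulr_rgt0 subr_lt0.
    have l2l : l < l2 by nra.
    have uv : v < s - r by rewrite lt_neqAle eq_sym nv (subgrad_slope_le sl h3).
    by rewrite pmulr_rgt0 subr_gt0.
  by lra.
apply: (main ((m + l) / 2)).
  by rewrite /unit_itv/=; apply/andP; split; lra.
have : m - l != 0 by rewrite subr_eq0.
have -> : (m - (m + l) / 2) * ((m + l) / 2 - l) = (m - l) ^+ 2 / 4 by field.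
by move=> ?; rewrite divr_gt0// exprn_even_gt0.
Qed.

End binary_divergence.

(** * Unbounded slopes near zero *)

Section steep.
Context {R : realType} {g : R -> R}.
Hypothesis exs : forall x, posreals x -> exists s, subgrad posreals g x s.
Hypothesis coh0 : coherent_at_0 g.
Local Notation U := (@unit_itv R).
Local Notation pos := (@posreals R).

Lemma binary_div_ext_half m : binary_div_ext g (1 / 2) (1 - m) = binary_div_ext g (1 / 2) m.
Proof.
rewrite /binary_div_ext addeC.
have -> : 1 - 1 / 2 = 1 / 2 :> R by field.
by have -> : 1 - (1 - m) = m :> R by ring.
Qed.

(** If the slopes of [g] are bounded below, the binary divergence has a finite
    slope at 0, and a large loss sends all the mass to failure. *)
Lemma strict_min_half_0 (K : R) :
  (forall x s, subgrad pos g x s -> - K <= s) ->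
  exists h, strict_min g (1 / 2) h 0.
Proof.
move=> hK.
have [s2 sg2] := exs 2 (ltr0n R 2).
have half01 : 0 < (1 / 2 : R) < 1 by apply/andP; split; lra.
have [s1 sg1] := exs 1 ltr01.
have fin0 : ext0 g 0 \is a fin_num.
  rewrite fin_numE; apply/andP; split.
    have := ext0_ge exs sg1 (lexx 0); by apply: contraTneq => ->.
  by have := ext0_le exs hK (ltr01 : 0 < 1); apply: contraTneq => ->.
have b0 : binary_div_ext g (1 / 2) 0 = (1 / 2 * fine (ext0 g 0) + 1 / 2 * g 2)%:E.
  rewrite /binary_div_ext mul0r subr0.
  have -> : 1 / (1 - 1 / 2) = 2 :> R by field.
  have -> : 1 - 1 / 2 = 1 / 2 :> R by field.
  by rewrite (ext0_pos g 2)// -{1}(fineK fin0) -!EFinM -EFinD.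
exists (K + s2 + 1); split=> [|m /andP[m0 m1] mN0]; first by rewrite lexx ler01.
have m_gt0 : 0 < m by rewrite lt_neqAle eq_sym mN0.
have h1 : ((fine (ext0 g 0) - K * (m * 2))%:E <= ext0 g (m / (1 / 2)))%E.
  have -> : m / (1 / 2) = m * 2 by field.
  rewrite (ext0_pos g (m * 2)) ?mulr_gt0// lee_fin.
  have := ext0_le exs hK (mulr_gt0 m_gt0 (ltr0n R 2)).
  by rewrite -(fineK fin0) lee_fin; lra.
have h2 : ((g 2 - s2 * (2 * m))%:E <= ext0 g ((1 - m) / (1 - 1 / 2)))%E.
  have -> : (1 - m) / (1 - 1 / 2) = 2 - 2 * m by field.
  have m2 : 0 <= 2 - 2 * m by lra.
  apply: le_trans (ext0_ge exs sg2 m2); rewrite lee_fin; lra.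
rewrite b0 {1}/binary_div_ext mulr0 adde0.
have -> : (1 - 1 / 2)%:E = (1 / 2 : R)%:E by congr EFin; field.
have half0 : (0 <= (1 / 2 : R)%:E)%E by rewrite lee_fin; lra.
apply: lt_le_trans (leeD (leeD (lee_wpmul2l half0 h1) (lee_wpmul2l half0 h2)) (lexx _)).
rewrite -!EFinM -!EFinD lte_fin; lra.
Qed.

(** Otherwise some [h] leads from mean [1 / 2] to mean 0, and by symmetry [- h]
    leads to mean 1; but [- h] is [h] followed by [- 2 * h], and mean 0 cannot be
    left. *)
Lemma steep v : exists x s, subgrad pos g x s /\ s < v.
Proof.
apply: contrapT => nex.
have hK x s : subgrad pos g x s -> - (- v) <= s.
  by rewrite opprK leNgt => sx; apply/negP => sv; apply: nex; exists x, s.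
have [h hmin] := strict_min_half_0 _ hK.
have half01 : 0 < (1 / 2 : R) < 1 by apply/andP; split; lra.
suff : 1 = 0 :> R by move/eqP; rewrite oner_eq0.
apply: (coh0 (1 / 2) h (- 2 * h)) => //.
have [_ hm] := hmin.
split=> [|m /andP[m0 m1] mN1]; first by rewrite ler01 lexx.
have := hm (1 - m); rewrite subr_eq0 eq_sym mN1 => /(_ _ isT).
have -> : 0 <= 1 - m <= 1 by apply/andP; split; lra.
move=> /(_ isT).
rewrite binary_div_ext_half.
have <- : binary_div_ext g (1 / 2) 1 = binary_div_ext g (1 / 2) 0.
  by rewrite -binary_div_ext_half subrr.
rewrite -(@lteD2rE _ (- h)%:E)// -!addeA -!EFinD.
have -> : h * 0 + - h = (h + - 2 * h) * 1 by ring.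
by have -> : h * (1 - m) + - h = (h + - 2 * h) * m by ring.
Qed.

(** Near 0 the first term of the binary divergence produces arbitrarily low slopes,
    near 1 the second one produces arbitrarily high slopes, and [v] lies between
    two of them. *)
Lemma ex_exposed p v : 0 < p < 1 -> ~ flat_slopes U (binary_div g p) v ->
  exists l, exposed (g := g) p v l.
Proof.
move=> p01 nf; have /andP[p0 p1] := p01.
have q0 : 0 < 1 - p by rewrite subr_gt0.
have [r1 sg1] := exs 1 ltr01.
have h0 : (0 : R) < 1 / 2 by lra.
(* The slopes at points above 1 are bounded below by any slope at 1/2; the point
   1/2 rather than 1 leaves a strict inequality, as slopes at 1 need not be unique. *)
have [rh sgh] := exs (1 / 2) h0.
have [x [s [sx slt]]] := steep (Num.min r1 (v + rh)).
have [y [t [sy tlt]]] := steep (Num.min r1 (rh - v)).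
move: slt tlt; rewrite !lt_min => /andP[s1 s2] /andP[t1 t2].
have x1 := subgrad_le sx sg1 s1; have y1 := subgrad_le sy sg1 t1.
have x0 : 0 < x := sx.1; have y0 : 0 < y := sy.1.
have big u w : 1 <= u -> subgrad pos g u w -> rh <= w.
  by move=> u1 su; apply: (subgrad_slope_le sgh su); lra.
have Ua : U (p * x) by rewrite /unit_itv/= mulr_gt0//=; nra.
have [a [b [ha hb hab]]] := ex_subgrad_binary_div exs p (p * x) p01 Ua.
have Ub : U (1 - (1 - p) * y) by rewrite /unit_itv/=; apply/andP; split; nra.
have [c [e [hc he hce]]] := ex_subgrad_binary_div exs p (1 - (1 - p) * y) p01 Ub.
have px : p * x / p = x by field; rewrite gt_eqF.
have qy : (1 - (1 - (1 - p) * y)) / (1 - p) = y by field; rewrite gt_eqF.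
have sxb : subgrad U (binary_div g p) (p * x) (s - b).
  by apply: subgrad_binary_div => //; rewrite px.
have syb : subgrad U (binary_div g p) (1 - (1 - p) * y) (c - t).
  by apply: subgrad_binary_div => //; rewrite qy.
have bb : rh <= b by apply: big hb; rewrite ler_pdivlMr// mul1r; nra.
have cc : rh <= c by apply: big hc; rewrite ler_pdivlMr// mul1r; nra.
have vv : s - b < v < c - t by apply/andP; split; lra.
have II : is_interval U.
  move=> u w /andP[u0 u1] /andP[w0 w1] z /andP[uz zw].
  by apply/andP; split; [exact: lt_le_trans uz|exact: le_lt_trans w1].
have exb l : U l -> exists r, subgrad U (binary_div g p) l r.
  by move=> /(ex_subgrad_binary_div exs p _ p01)[k [j [_ _ ?]]]; exists (k - j).
have [l _ sl] := ex_subgrad_between II exb sxb syb vv.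
exists l; split=> // m sm.
by case: (ltgtP m l) => // ml; case: nf; [exists m, l|exists l, m].
Qed.

End steep.

(** * Coherence and subdifferentials *)

Lemma countable_or {R : realType} (A B : set R) :
  countable A -> countable B -> countable [set x | A x \/ B x].
Proof.
move=> cA cB; have -> : [set x | A x \/ B x] = \bigcup_(b in [set: bool]) (if b then A else B).
  apply/seteqP; split=> x; first by case=> ?; [exists true|exists false].
  by move=> [[] _ ?]; [left|right].
by apply: bigcup_countable => // -[].
Qed.

Lemma countable_shift {R : realType} (v : R) (A : set R) :
  countable A -> countable [set w | A (v + w)].
Proof.
move=> cA; have -> : [set w | A (v + w)] = (fun u => u - v) @` A.
  apply/seteqP; split=> [w Aw|_ [u Au <-]]; first by exists (v + w) => //; ring.
  by rewrite /= addrC subrK.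
exact: sub_countable (card_image_le _ _) cA.
Qed.

Section coherence.
Context {R : realType} {g : R -> R}.
Local Notation U := (@unit_itv R).
Local Notation pos := (@posreals R).
Hypothesis exs : forall x, pos x -> exists s, subgrad pos g x s.
Hypothesis coh0 : coherent_at_0 g.
Hypothesis coh1 : coherent_inside g.
Local Notation flat p := (flat_slopes U (binary_div g p)).
Local Notation exposed := (exposed (g := g)).

Lemma coherent_exposed p v w l m m' : 0 < p < 1 ->
  exposed p v l -> exposed l w m -> exposed p (v + w) m' -> m' = m.
Proof.
move=> p01 e1 e2 e3; have l01 : 0 < l < 1 := e1.1.1.
apply: (coh1 p l (- v) (- w)) => //; [exact: exposed_strict_min..|].
by rewrite -opprD; exact: exposed_strict_min.
Qed.

(** Both slopes are generic, hence each is attained at exactly one point, and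
    coherence identifies the two points. *)
Lemma subgrad_shift p v w l m : 0 < p < 1 -> exposed p v l ->
  ~ flat l w -> ~ flat p (v + w) ->
  subgrad U (binary_div g l) m w <-> subgrad U (binary_div g p) m (v + w).
Proof.
move=> p01 e1 nl np; have l01 : 0 < l < 1 := e1.1.1.
have [m1 em1] := ex_exposed exs coh0 _ _ l01 nl.
have [m2 em2] := ex_exposed exs coh0 _ _ p01 np.
have e12 := coherent_exposed _ _ _ _ _ _ p01 e1 em1 em2.
split=> [/em1.2|/em2.2] ->; first by rewrite -e12; exact: em2.1.
by rewrite e12; exact: em1.1.
Qed.

(** Suppose that the slopes at [l] reach from below [v1] to above [v2], with
    [v1 < v2].  Both slopes are attained only at [l], so by [subgrad_shift] a generic
    [w] is a slope of [binary_div g l] at [l] exactly if [v1 + w] is a slope of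
    [binary_div g p] at [l], and exactly if [v2 + w] is one.  This fails when the
    largest slope at [l] separates [v1 + w] from [v2 + w]. *)
Lemma binary_div_slope_unique p l v v' : 0 < p < 1 ->
  subgrad U (binary_div g p) l v -> subgrad U (binary_div g p) l v' -> v = v'.
Proof.
move=> p01.
suff main u u' : subgrad U (binary_div g p) l u -> subgrad U (binary_div g p) l u' ->
    u < u' -> False.
  by move=> sv sv'; case: (ltgtP v v') => // lt; [case: (main v v')|case: (main v' v)].
move=> su su' uu'; have /andP[l0 l1] := su.1; have l01 : 0 < l < 1 := su.1.
pose K := [set w | subgrad U (binary_div g p) l w].
have Uz : U ((l + 1) / 2) by rewrite /unit_itv/=; apply/andP; split; lra.
have [s [r [_ _ sz]]] := ex_subgrad_binary_div exs p _ p01 Uz.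
have hK : has_sup K.
  split; first by exists u.
  by exists (s - r) => w sw; apply: (subgrad_slope_le sw sz); lra.
have u'b : u' <= sup K by exact: sup_upper_bound.
have inK w : u < w -> w < sup K -> K w.
  move=> uw wb; have e0 : 0 < sup K - w by rewrite subr_gt0.
  have [w' Kw'] := sup_adherent e0 hK.
  rewrite opprB addrC subrK => ww'.
  split=> [//|z Uz']; have := Kw'.2 z Uz'; have := su.2 z Uz'.
  by case: (leP l z) => ?; nra.
have expo w : u < w -> w < sup K -> exposed p w l.
  move=> uw wb; split; first exact: inK.
  move=> m sm; have [w' [uw' ww']] : exists w', w < w' /\ K w'.
    exists ((w + sup K) / 2); split; first by lra.
    by apply: inK; lra.
  have h1 := subgrad_le su sm uw; have h2 := subgrad_le sm ww' uw'.
  by apply: le_anti; rewrite h2.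
(* Thirds keep v1 + w above u when w is larger than sup K - v2. *)
pose v1 := (2 * u + u') / 3; pose v2 := (u + 2 * u') / 3.
have v12 : v1 < v2 by rewrite /v1 /v2; lra.
have uv1 : u < v1 by rewrite /v1; lra.
have v2u' : v2 < u' by rewrite /v2; lra.
have cc : countable [set w | flat l w \/ [set w | flat p (v1 + w) \/ flat p (v2 + w)] w].
  apply: countable_or; first exact: countable_flat_slopes.
  by apply: countable_or; apply: countable_shift; exact: countable_flat_slopes.
have lt : sup K - v2 < sup K - v1 by lra.
have [w /andP[w2 w1] nw] := ex_notin_countable _ _ _ cc lt.
have /not_orP[nl /not_orP[n1 n2]] := nw.
have e1 : exposed p v1 l by apply: expo; lra.
have e2 : exposed p v2 l by apply: expo; lra.
have k1 : K (v1 + w) by apply: inK; move: w2 w1 v12 uv1 v2u' u'b; rewrite /v1 /v2; lra.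
have : K (v2 + w).
  apply/(subgrad_shift _ _ _ _ _ p01 e2 nl n2).
  by apply/(subgrad_shift _ _ _ _ _ p01 e1 nl n1).
move=> k2; have := sup_upper_bound hK k2; lra.
Qed.

(** Two slopes of [g] at [x] would give two slopes of the binary divergence at
    [l = p * x], as soon as [p] is small enough for [l] to be less than 1. *)
Lemma slope_unique x s t : subgrad pos g x s -> subgrad pos g x t -> s = t.
Proof.
move=> sx tx; have x0 : 0 < x := sx.1.
pose p := 1 / (2 * (x + 1)); pose l := p * x.
have p0 : 0 < p by rewrite divr_gt0 ?mulr_gt0 ?addr_gt0.
have e : p * (2 * (x + 1)) = 1 by rewrite /p; field; rewrite gt_eqF ?addr_gt0.
have p1 : p < 1 by nra.
have p01 : 0 < p < 1 by rewrite p0.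
have Ul : U l by rewrite /unit_itv/= /l mulr_gt0//=; nra.
have [_ [r [_ sr _]]] := ex_subgrad_binary_div exs p _ p01 Ul.
have lp : l / p = x by rewrite /l; field; rewrite gt_eqF.
have h1 : subgrad U (binary_div g p) l (s - r) by apply: subgrad_binary_div; rewrite ?lp.
have h2 : subgrad U (binary_div g p) l (t - r) by apply: subgrad_binary_div; rewrite ?lp.
by have := binary_div_slope_unique _ _ _ _ p01 h1 h2; lra.
Qed.

Context {phi : R -> R}.
Hypothesis phiP : forall x, pos x -> subgrad pos g x (phi x).

Lemma selection_le x y : 0 < x -> x <= y -> phi x <= phi y.
Proof.
move=> x0; rewrite le_eqVlt => /predU1P[->//|xy].
by apply: (subgrad_slope_le (phiP _ x0) (phiP y _)) => //; exact: lt_trans xy.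
Qed.

Lemma selection_eq x s : subgrad pos g x s -> s = phi x.
Proof. by move=> sx; apply: (slope_unique _ _ _ sx); apply: phiP sx.1. Qed.

Definition binary_div_slope p l := phi (l / p) - phi ((1 - l) / (1 - p)).

Lemma binary_div_slopeP p l : 0 < p < 1 -> U l ->
  subgrad U (binary_div g p) l (binary_div_slope p l).
Proof.
move=> p01 Ul; have /andP[p0 p1] := p01; have /andP[l0 l1] := Ul.
by apply: subgrad_binary_div => //; apply: phiP; rewrite /posreals/= divr_gt0// subr_gt0.
Qed.

(** If the two sides differed, a generic [w] between [binary_div_slope l m] and
    [binary_div_slope p m - v] would be attained, by [subgrad_shift], at a point that is
    both at most and at least [m], against the uniqueness of slopes. *)
Lemma binary_div_slope_cocycle p v l m : 0 < p < 1 -> exposed p v l -> U m ->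
  binary_div_slope p m = v + binary_div_slope l m.
Proof.
move=> p01 e1 Um; have Ul : U l := e1.1.1; have l01 : 0 < l < 1 := Ul.
have sp := binary_div_slopeP _ _ p01 Um; have sl := binary_div_slopeP _ _ l01 Um.
have cc : countable [set w | flat l w \/ [set w | flat p (v + w)] w].
  apply: countable_or; first exact: countable_flat_slopes.
  by apply: countable_shift; exact: countable_flat_slopes.
have key a b : a < b -> exists w k, [/\ a < w < b, subgrad U (binary_div g l) k w
    & subgrad U (binary_div g p) k (v + w)].
  move=> ab; have [w wab /not_orP[nl np]] := ex_notin_countable _ _ _ cc ab.
  have [k ek] := ex_exposed exs coh0 _ _ l01 nl.
  exists w, k; split => //; first exact: ek.1.
  by apply/(subgrad_shift _ _ _ _ _ p01 e1 nl np); exact: ek.1.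
case: (ltgtP (binary_div_slope p m) (v + binary_div_slope l m)) => // h.
- have /key[w [k [/andP[w1 w2] h1 h2]]] : binary_div_slope p m - v < binary_div_slope l m.
    by lra.
  have mk : m <= k by apply: (subgrad_le sp h2); lra.
  have km : k <= m by apply: (subgrad_le h1 sl).
  have km' : k = m by apply: le_anti; rewrite km.
  rewrite km' in h1; have := binary_div_slope_unique _ _ _ _ l01 h1 sl; lra.
- have /key[w [k [/andP[w1 w2] h1 h2]]] : binary_div_slope l m < binary_div_slope p m - v.
    by lra.
  have mk : m <= k by apply: (subgrad_le sl h1).
  have km : k <= m by apply: (subgrad_le h2 sp); lra.
  have km' : k = m by apply: le_anti; rewrite km.
  rewrite km' in h1; have := binary_div_slope_unique _ _ _ _ l01 h1 sl; lra.
Qed.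

End coherence.

(** * The functional equation *)

Section functional_equation.
Context {R : realType} {g : R -> R}.
Local Notation U := (@unit_itv R).
Local Notation pos := (@posreals R).
Hypothesis exs : forall x, pos x -> exists s, subgrad pos g x s.
Hypothesis coh0 : coherent_at_0 g.
Hypothesis coh1 : coherent_inside g.
Context {phi : R -> R}.
Hypothesis phiP : forall x, pos x -> subgrad pos g x (phi x).
Let phi_le := @selection_le R g phi phiP.
Let phi_eq := @selection_eq R g exs coh0 coh1 phi phiP.

Definition strict_at x := 0 < x /\ forall y, 0 < y -> phi y = phi x -> y = x.

Lemma ex_strict_at a b v : 0 < a -> 0 < b -> phi a < v < phi b ->
  ~ flat_slopes pos g v -> exists2 x, strict_at x & phi x = v.
Proof.
move=> a0 b0 vab nf.
have II : is_interval pos.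
  by move=> u w u0 w0 z /andP[uz zw]; exact: lt_le_trans uz.
have [x _ sx] := ex_subgrad_between II exs (phiP _ a0) (phiP _ b0) vab.
have xv := phi_eq _ _ sx.
exists x => //; split; first exact: sx.1.
move=> y y0 yx; have sy := phiP _ y0; rewrite yx -xv in sy.
by case: (ltgtP y x) => // lt; case: nf; [exists y, x|exists x, y].
Qed.

(** A jump of [phi] at 1 would leave out values that [ex_subgrad_between] shows to
    be taken; only continuity at 1 is needed for the limit of small atoms. *)
Lemma phi_cvg1 : phi x @[x --> (1 : R)] --> phi 1.
Proof.
have II : is_interval pos.
  by move=> u w u0 w0 z /andP[uz zw]; exact: lt_le_trans uz.
have half0 : (0 : R) < 1 / 2 by lra.
have up e : 0 < e -> exists2 y, 1 < y & phi y < phi 1 + e.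
  move=> e0; apply: contrapT => nex.
  have h y : 1 < y -> phi 1 + e <= phi y.
    by move=> y1; rewrite leNgt; apply/negP => ylt; apply: nex; exists y.
  have v12 : phi 1 < phi 1 + e / 2 < phi 2.
    by have := h 2 (ltr1n R 2); rewrite ltrDl divr_gt0//= => ?; lra.
  have [x /andP[x1 x2] sx] := ex_subgrad_between II exs
    (phiP 1 ltr01) (phiP 2 (ltr0n R 2)) v12.
  have xv := phi_eq _ _ sx; move: x1; rewrite le_eqVlt => /predU1P[x1|/h]; last by lra.
  by move: xv; rewrite -x1; lra.
have down e : 0 < e -> exists2 y, 0 < y < 1 & phi 1 - e < phi y.
  move=> e0; apply: contrapT => nex.
  have h y : 0 < y < 1 -> phi y <= phi 1 - e.
    by move=> y1; rewrite leNgt; apply/negP => ylt; apply: nex; exists y.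
  have v12 : phi (1 / 2) < phi 1 - e / 2 < phi 1.
    have := h (1 / 2); have -> : 0 < (1 / 2 : R) < 1 by apply/andP; split; lra.
    by move=> /(_ isT) ?; apply/andP; split; lra.
  have [x /andP[x1 x2] sx] := ex_subgrad_between II exs
    (phiP _ half0) (phiP 1 ltr01) v12.
  have xv := phi_eq _ _ sx.
  have x0 : 0 < x := sx.1.
  move: x2; rewrite le_eqVlt => /predU1P[x2|x2]; first by move: xv; rewrite x2; lra.
  by have := h x; rewrite x0 x2 => /(_ isT); lra.
apply/cvgrPdist_lt => e e0.
have [b b1 phib] := up e e0; have [a /andP[a0 a1] phia] := down e e0.
near=> x.
have ax : a < x by near: x; apply: lt_nbhsr.
have xb : x < b by near: x; apply: lt_nbhsl.
have h1 := phi_le _ _ a0 (ltW ax); have h2 := phi_le _ _ (lt_trans a0 ax) (ltW xb).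
by rewrite distrC ltr_distl; apply/andP; split; lra.
Unshelve. all: by end_near.
Qed.

Lemma phi_cvg_ratio x z : phi ((1 - p * z) / (1 - p * x)) @[p --> 0^'+] --> phi 1.
Proof.
apply: (@cvg_comp _ _ _ (fun p => (1 - p * z) / (1 - p * x)) phi _ (nbhs (1 : R)));
  last exact: phi_cvg1.
apply: cvg_at_right_filter.
have c w : 1 - p * w @[p --> (0 : R)] --> (1 : R).
  rewrite -[X in _ --> X]subr0 -[X in _ - X](mul0r w).
  apply: cvgB; first exact: cvg_cst.
  by apply: cvgMl; exact: cvg_id.
rewrite -[X in _ --> X](divr1 1).
by apply: cvgM; [exact: c|apply: cvgV; [exact: oner_neq0|exact: c]].
Qed.

(** The slope of the binary divergence at [m] is a sum of two nondecreasing functions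
    of [m], and the first one takes its value at [p * x] nowhere else. *)
Lemma strict_exposed p x : 0 < p < 1 -> strict_at x -> p * x < 1 ->
  exposed (g := g) p (binary_div_slope (phi := phi) p (p * x)) (p * x).
Proof.
move=> p01 [x0 sx] px1; have /andP[p0 p1] := p01.
have Ux : U (p * x) by rewrite /unit_itv/= mulr_gt0.
have q0 : 0 < 1 - p by rewrite subr_gt0.
split; first exact: binary_div_slopeP.
move=> m sm; have Um : U m := sm.1; have /andP[m0 m1] := Um.
have := binary_div_slope_unique exs coh0 coh1 _ _ _ _ p01 sm (binary_div_slopeP exs phiP _ _ p01 Um).
rewrite /binary_div_slope.
have pxx : p * x / p = x by field; rewrite gt_eqF.
rewrite pxx => e.
suff mx : m / p = x by rewrite -mx; field; rewrite gt_eqF.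
apply: sx; first by rewrite divr_gt0.
have mp0 : 0 < m / p by rewrite divr_gt0.
have ma : 0 < (1 - m) / (1 - p) by rewrite divr_gt0 ?subr_gt0.
have mb : 0 < (1 - p * x) / (1 - p) by rewrite divr_gt0 ?subr_gt0.
have [mpx|pxm] := leP m (p * x).
  have h1 : m / p <= x by rewrite ler_pdivrMr// mulrC.
  have h2 : (1 - p * x) / (1 - p) <= (1 - m) / (1 - p) by rewrite ler_pM2r ?invr_gt0// lerB.
  by have := phi_le _ _ mp0 h1; have := phi_le _ _ mb h2; lra.
have h1 : x <= m / p by rewrite ler_pdivlMr// mulrC ltW.
have h2 : (1 - m) / (1 - p) <= (1 - p * x) / (1 - p) by rewrite ler_pM2r ?invr_gt0// lerB// ltW.
by have := phi_le _ _ x0 h1; have := phi_le _ _ ma h2; lra.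
Qed.

(** The limit, as [p] tends to 0, of the cocycle identity at [l = p * x] and
    [m = p * z]. *)
Lemma strict_additive x z : strict_at x -> 0 < z ->
  phi z = phi x + phi (z / x) - phi 1.
Proof.
move=> sx z0; have x0 := sx.1.
(* 1 - p is written 1 - p * 1 so that the three limits are instances of
   phi_cvg_ratio. *)
pose F p := phi x - phi ((1 - p * x) / (1 - p * 1)) + phi (z / x)
  - phi ((1 - p * z) / (1 - p * x)) + phi ((1 - p * z) / (1 - p * 1)).
have cF : F p @[p --> 0^'+] --> phi x - phi 1 + phi (z / x) - phi 1 + phi 1.
  apply: cvgD; last exact: phi_cvg_ratio.
  apply: cvgB; last exact: phi_cvg_ratio.
  apply: cvgD; last exact: cvg_cst.
  apply: cvgB; last exact: phi_cvg_ratio.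
  exact: cvg_cst.
suff cz : F p @[p --> 0^'+] --> phi z.
  by rewrite (cvg_unique _ cz cF) //; ring.
apply: cvg_near_cst; near=> p.
have p0 : 0 < p by near: p; exact: nbhs_right_gt.
have p1 : p < 1 by near: p; exact: nbhs_right_lt.
have p01 : 0 < p < 1 by rewrite p0.
have px : p < 1 / x by near: p; apply: nbhs_right_lt; rewrite divr_gt0.
have pz : p < 1 / z by near: p; apply: nbhs_right_lt; rewrite divr_gt0.
rewrite ltr_pdivlMr// in px; rewrite ltr_pdivlMr// in pz.
have Uz : U (p * z) by rewrite /unit_itv/= mulr_gt0.
have := binary_div_slope_cocycle exs coh0 coh1 phiP _ _ _ _ p01 (strict_exposed p x p01 sx px) Uz.
rewrite /binary_div_slope /F mulr1.
have -> : p * z / p = z by field; rewrite gt_eqF.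
have -> : p * x / p = x by field; rewrite gt_eqF.
have -> : p * z / (p * x) = z / x by field; rewrite !gt_eqF.
move=> e; apply/eqP; lra.
Unshelve. all: by end_near.
Qed.

Lemma phi_low v : exists2 a, 0 < a & phi a < v.
Proof.
have [x [s [sx sv]]] := steep exs coh0 v.
by exists x; [exact: sx.1|rewrite -(phi_eq _ _ sx)].
Qed.

(** A point with a very low slope that is attained only there; its inverse has a
    very high slope by [strict_additive] with [z = 1]. *)
Lemma phi_high v : exists2 b, 0 < b & v < phi b.
Proof.
have [a1 a10 h1] := phi_low (2 * phi 1 - v).
have [a2 a20 h2] := phi_low (phi a1).
have [w wa nf] := ex_notin_countable _ _ _ (countable_flat_slopes pos g) h2.
have [x sx xw] := ex_strict_at _ _ _ a20 a10 wa nf.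
exists (1 / x); first by rewrite divr_gt0// sx.1.
have := strict_additive x 1 sx ltr01; lra.
Qed.

(** The values [phi x'] at points where [strict_additive] applies are dense, and
    [phi] is nondecreasing: [phi (x * y)] is squeezed between [phi (x' * y)] for
    nearby [x'] on both sides. *)
Lemma phi_mul x y : 0 < x -> 0 < y -> phi (x * y) = phi x + phi y - phi 1.
Proof.
move=> x0 y0.
have gen u w : u < w -> exists x', [/\ strict_at x', u < phi x' & phi x' < w].
  move=> uw; have [v /andP[uv vw] nf] := ex_notin_countable _ _ _ (countable_flat_slopes pos g) uw.
  have [a a0 av] := phi_low v; have [b b0 vb] := phi_high v.
  have vab : phi a < v < phi b by rewrite av.
  have [x' sx' xv] := ex_strict_at _ _ _ a0 b0 vab nf.
  by exists x'; rewrite xv.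
have inv (u w : R) : 0 < u -> w * u / u = w.
  by move=> u0; field; rewrite gt_eqF.
apply/eqP; rewrite eq_le; apply/andP; split; apply/ler_addgt0Pr => e e0.
  have lt : phi x < phi x + e by rewrite ltrDl.
  have [x' [sx' h1 h2]] := gen _ _ lt; have x'0 := sx'.1.
  have xx' : x <= x'.
    by case: (leP x x') => // /ltW /(phi_le _ _ x'0); lra.
  have := strict_additive x' (y * x') sx' (mulr_gt0 y0 x'0); rewrite inv//.
  have : phi (x * y) <= phi (y * x').
    by apply: phi_le; [exact: mulr_gt0|rewrite mulrC ler_pM2l].
  lra.
have lt : phi x - e < phi x by rewrite ltrBlDr ltrDl.
have [x' [sx' h1 h2]] := gen _ _ lt; have x'0 := sx'.1.
have xx' : x' <= x.
  by case: (leP x' x) => // /ltW /(phi_le _ _ x0); lra.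
have := strict_additive x' (y * x') sx' (mulr_gt0 y0 x'0); rewrite inv//.
have : phi (y * x') <= phi (x * y).
  by apply: phi_le; [exact: mulr_gt0|rewrite mulrC ler_pM2r].
lra.
Qed.

End functional_equation.

(** * From slopes to the function *)

Lemma monotone_additive_linear {R : realType} (F : R -> R) :
  (forall s t, F (s + t) = F s + F t) -> {homo F : s t / s <= t} ->
  forall t, F t = t * F 1.
Proof.
move=> FD Fle.
have F0 : F 0 = 0 by have := FD 0 0; rewrite addr0; lra.
have FN t : F (- t) = - F t by have := FD t (- t); rewrite subrr F0; lra.
have Fn t n : F (t *+ n) = F t *+ n.
  by elim: n => [|n IH]; rewrite ?mulr0n// !mulrS FD IH.
have Fz (m : int) : F m%:~R = m%:~R * F 1.
  case: m => n; first by rewrite -[LHS]/(F (1 *+ n)) Fn mulr_natl.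
  by rewrite NegzE mulrNz FN -[in LHS]/(F (1 *+ n.+1)) Fn mulNr mulr_natl.
have F1 : 0 <= F 1 by rewrite -F0; exact: Fle.
move=> t.
(* t *+ n lies between two consecutive integers, where F is known, so that n times
   the error stays below F 1. *)
have bound n : `|F t - t * F 1| *+ n <= F 1.
  rewrite -normrMn mulrnBl -Fn.
  have /andP[h1 h2] := floor_itv (t *+ n).
  have := Fle _ _ h1; have := Fle _ _ (ltW h2).
  rewrite Fz Fz -mulrnAl ler_norml intrD.
  have h3 := ler_wpM2r F1 h1; have h4 := ler_wpM2r F1 (ltW h2).
  rewrite intrD in h4.
  by move=> h5 h6; apply/andP; split; lra.
apply/eqP; rewrite -subr_eq0 -normr_le0 leNgt; apply/negP => pos.
have := bound (Num.bound (F 1 / `|F t - t * F 1|)).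
have := archi_boundP (divr_ge0 F1 (ltW pos)).
by rewrite ltr_pdivrMr// mulr_natl => /lt_le_trans /[apply]; rewrite ltxx.
Qed.

(** The increments of [H] are negligible compared with those of the variable, hence
    its derivative is 0 everywhere. *)
Lemma cst_of_small_increments {R : realType} (H W : R -> R) :
  continuous W ->
  (forall s t, `|H s - H t| <= `|s - t| * `|W s - W t|) ->
  forall s t, H s = H t.
Proof.
move=> cW hH s t; apply: is_derive_0_is_cst => x.
have c : h^-1 *: ((H \o shift x) (h *: 1) - H x) @[h --> (0 : R)^'] --> (0 : R).
  apply/cvgrPdist_le => e e0.
  have : W (h + x) @[h --> (0 : R)] --> W x.
    have cx : h + x @[h --> (0 : R)] --> 0 + x.
      by apply: cvgD; [exact: cvg_id|exact: cvg_cst].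
    by rewrite add0r in cx; exact: cvg_comp cx (cW x).
  move=> /cvgrPdist_le /(_ e e0) near0.
  near=> h.
  have hN0 : h != 0 by near: h; exact: nbhs_dnbhs_neq.
  have wh : `|W x - W (h + x)| <= e by near: h; exact: nbhs_dnbhs.
  rewrite sub0r normrN normrZ normfV /= mulrC ler_pdivrMr ?normr_gt0//.
  rewrite [h *: 1]mulr1; apply: le_trans (hH _ _) _.
  by rewrite addrK mulrC ler_pM2r ?normr_gt0// distrC.
apply: DeriveDef; first by apply/cvg_ex; exists 0.
by rewrite /derive; exact: cvg_lim.
Unshelve. all: by end_near.
Qed.

Section explicit.
Context {R : realType} {g : R -> R}.
Local Notation pos := (@posreals R).
Context {k c : R}.
Hypothesis k0 : 0 < k.

(** The integrand of [k] times the Kullback-Leibler divergence, up to terms in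
    [x - 1], normalized so that its slope at 1 is [c].  As [ln 0] is 0 by
    convention, its value at 0 is its limit there. *)
Definition klfun (k c x : R) : R := k * (x * ln x - x + 1) + c * (x - 1).

Lemma ln_le_sub1 (x : R) : 0 < x -> ln x <= x - 1.
Proof.
by move=> x0; have := @le_ln1Dx R (x - 1); rewrite [1 + _]addrC subrK; apply; lra.
Qed.

Lemma subgrad_klfun x : 0 < x -> subgrad pos (klfun k c) x (c + k * ln x).
Proof.
move=> x0; split=> // y y0; rewrite /klfun.
have y0' : 0 < y := y0.
have := ln_le_sub1 _ (divr_gt0 x0 y0'); rewrite ln_div ?posrE//.
have -> : x / y - 1 = (x - y) / y by field; rewrite gt_eqF.
rewrite ler_pdivlMr// => h.
have := ler_wpM2l (ltW k0) h; nra.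
Qed.

Hypothesis sg : forall x, 0 < x -> subgrad pos g x (c + k * ln x).

(** A convex function is determined by its slopes: the difference of two functions
    with the same slopes has increments of second order.  The change of variable
    [x = expR t] makes it a function on the whole line. *)
Lemma klfun_unique : g 1 = 0 -> forall x, 0 < x -> g x = klfun k c x.
Proof.
move=> g1.
pose H t := g (expR t) - klfun k c (expR t).
have Hst s t : `|H s - H t| <= `|s - t| * `|k * expR s - k * expR t|.
  have es := expR_gt0 s; have et := expR_gt0 t.
  have := (sg _ es).2 _ et; have := (sg _ et).2 _ es.
  have := (subgrad_klfun _ es).2 _ et; have := (subgrad_klfun _ et).2 _ es.
  rewrite !expRK -normrM => a1 a2 a3 a4.
  have : `|H s - H t| <= (s - t) * (k * expR s - k * expR t).
    by rewrite ler_norml /H; apply/andP; split; lra.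
  by move=> /le_trans; apply; exact: ler_norm.
have cW : continuous (fun s : R => k * expR s).
  by move=> x; apply: cvgMr; exact: continuous_expR.
have Hc := cst_of_small_increments _ _ cW Hst.
move=> x x0; have := Hc (ln x) 0.
rewrite /H lnK ?posrE// expR0 g1 /klfun ln1; lra.
Qed.

End explicit.

Lemma coherent_convex_klfun {R : realType} {g : R -> R} :
  convex_function (`]0, +oo[ : set R) g -> g 1 = 0 ->
  coherent_at_0 g -> coherent_inside g ->
  exists k c, 0 < k /\ forall x, 0 < x -> g x = klfun k c x.
Proof.
move=> cg g1 coh0 coh1; have exs := convex_ex_subgrad g cg.
have /choice[phi phiP] : forall x, exists s, posreals x -> subgrad posreals g x s.
  by move=> x; have [/exs[s ?]|nx] := pselect (posreals x); [exists s|exists 0].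
have lin := monotone_additive_linear (fun t => phi (expR t) - phi 1).
have phiE x : 0 < x -> phi x = phi 1 + (phi (expR 1) - phi 1) * ln x.
  move=> x0; rewrite mulrC -lin ?lnK ?posrE//; first by ring.
    move=> s t; rewrite expRD (phi_mul exs coh0 coh1 phiP) ?expR_gt0//; ring.
  move=> s t st; rewrite lerB//; apply: (selection_le phiP); first exact: expR_gt0.
  by rewrite ler_expR.
have k0 : 0 < phi (expR 1) - phi 1.
  have : phi 1 <= phi (expR 1).
    by apply: (selection_le phiP) => //; rewrite -expR0 ler_expR.
  rewrite le_eqVlt => /predU1P[e|]; last by rewrite subr_gt0.
  have [a a0] := phi_low exs coh0 coh1 phiP (phi 1).
  by rewrite (phiE _ a0) -e subrr mul0r addr0 ltxx.
exists (phi (expR 1) - phi 1), (phi 1); split => //.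
apply: klfun_unique => // x x0.
by rewrite -phiE//; exact: phiP.
Qed.

(** * Two-point measures *)

Section convex_measurable.
Context {R : realType} {g : R -> R}.
Hypothesis exs : forall x, posreals x -> exists s, subgrad posreals g x s.

Lemma convex_continuous_at (x : R) : 0 < x -> g y @[y --> x] --> g x.
Proof.
move=> x0; have x2 : 0 < x / 2 by rewrite divr_gt0.
have x3 : 0 < 2 * x by rewrite mulr_gt0.
have [sx hx] := exs _ x0; have [s2 h2] := exs _ x2; have [s3 h3] := exs _ x3.
pose C := `|sx| + `|s2| + `|s3| + 1.
have C0 : 0 < C by rewrite /C; have := (normr_ge0 sx, normr_ge0 s2, normr_ge0 s3) => -[[]]; lra.
apply/cvgrPdist_lt => e e0; near=> y.
have y2 : x / 2 < y by near: y; apply: lt_nbhsr; lra.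
have y3 : y < 2 * x by near: y; apply: lt_nbhsl; lra.
have ye : `|x - y| < e / C.
  by near: y; apply: cvgr_dist_lt; [exact: cvg_id|exact: divr_gt0].
have y0 : 0 < y by lra.
have [sy hy] := exs _ y0.
have l1 := subgrad_slope_le h2 hy y2; have l2 := subgrad_slope_le hy h3 y3.
have u1 := hx.2 _ y0; have u2 := hy.2 _ x0.
have sxC : `|sx| <= C by rewrite /C; have := (normr_ge0 s2, normr_ge0 s3) => -[]; lra.
have syC : `|sy| <= C.
  have := ler_norm s3; have := ler_norm (- s2); have := normr_ge0 sx.
  have := normr_ge0 s2; have := normr_ge0 s3; rewrite normrN /C => *.
  by rewrite ler_norml; apply/andP; split; lra.
have b1 : `|sx * (y - x)| < e.
  rewrite normrM distrC; apply: le_lt_trans (ler_wpM2r (normr_ge0 _) sxC) _.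
  by rewrite mulrC -ltr_pdivlMr.
have b2 : `|sy * (x - y)| < e.
  rewrite normrM; apply: le_lt_trans (ler_wpM2r (normr_ge0 _) syC) _.
  by rewrite mulrC -ltr_pdivlMr.
move: b1 b2; rewrite !ltr_norml => /andP[? ?] /andP[? ?].
by apply/andP; split; lra.
Unshelve. all: by end_near.
Qed.

Lemma measurable_ext0 : measurable_fun [set: R] (ext0 g).
Proof.
apply: measurable_fun_if => //.
- exact: measurable_fun_ltr.
- apply/measurable_EFinP.
  have -> : [set: R] `&` (fun r => 0 < r) @^-1` [set true] = [set` `]0, +oo[].
    by rewrite setTI; apply/seteqP; split => x /=; rewrite in_itv/= andbT.
  apply: open_continuous_measurable_fun; first exact: interval_open.
  by move=> x; rewrite inE /= in_itv/= andbT; exact: convex_continuous_at.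
Qed.

Lemma ext0_gtNy r : (-oo < ext0 g r)%E.
Proof.
have [s1 sg1] := exs 1 ltr01.
have [r0|r0] := ltP 0 r; first by rewrite ext0_pos// ltNyr.
have -> : ext0 g r = ext0 g 0 by rewrite /ext0 ltxx ltNge r0.
by apply: lt_le_trans (ext0_ge exs sg1 (lexx 0)); exact: ltNyr.
Qed.

End convex_measurable.

Section two_point.
Context {d : measure_display} {T : measurableType d} {R : realType}.
Context {a b : T} {A : set T}.
Hypothesis mA : measurable A.
Hypothesis Aa : A a.
Hypothesis Ab : ~ A b.

Definition two_point (P : probability T R) (p : R) : Prop :=
  forall B, measurable B -> P B = (p * \1_B a + (1 - p) * \1_B b)%:E.

Section construction.
Context {p : R} (p0 : 0 <= p) (q0 : 0 <= 1 - p).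

Definition two_point_measure : set T -> \bar R :=
  measure_add (mscale (NngNum p0) \d_a) (mscale (NngNum q0) \d_b).

HB.instance Definition _ := Measure.on two_point_measure.

Lemma two_point_measureE B :
  two_point_measure B = (p * \1_B a + (1 - p) * \1_B b)%:E.
Proof. by rewrite /two_point_measure measure_addE /mscale/= /dirac EFinD !EFinM. Qed.

Let two_point_measureT : two_point_measure setT = 1%E.
Proof. by rewrite two_point_measureE !indicT !mulr1 addrC subrK. Qed.

HB.instance Definition _ :=
  Measure_isProbability.Build _ _ _ two_point_measure two_point_measureT.

Definition two_point_probability : probability T R := two_point_measure.

End construction.

Lemma ex_two_point {p} : 0 <= p <= 1 -> exists P, two_point P p.
Proof.
move=> /andP[p0 p1]; have q0 : 0 <= 1 - p by rewrite subr_ge0.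
by exists (two_point_probability p0 q0) => B mB; exact: two_point_measureE.
Qed.

Lemma two_point_eq {P Q p} : two_point P p -> two_point Q p -> measure_eq P Q.
Proof. by move=> hP hQ B mB; exact: etrans (hP B mB) (esym (hQ B mB)). Qed.

Lemma two_point_set {P p} : two_point P p -> P A = p%:E.
Proof.
move=> hP; rewrite hP// !indicE (mem_set Aa) memNset//.
by rewrite mulr1 mulr0 addr0.
Qed.

Lemma dominatesP (mu P : probability T R) :
  mu `<< P <-> forall B, measurable B -> P B = 0%E -> mu B = 0%E.
Proof. by split=> [/null_content_dominatesP//|h]; apply/null_content_dominatesP. Qed.

(** A measurable set that contains neither [a] nor [b] is null, so that only the mass
    of [A] and that of its complement matter. *)
Lemma two_point_dominated {mu P : probability T R} {p} : two_point P p ->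
  mu `<< P -> exists2 m, 0 <= m <= 1 & two_point mu m.
Proof.
move=> hP /dominatesP dom.
have fA : mu A \is a fin_num by exact: fin_num_measure.
exists (fine (mu A)).
  by rewrite fine_ge0//= -lee_fin fineK// probability_le1.
have mC : measurable (~` A) by exact: measurableC.
have muC : mu (~` A) = (1 - fine (mu A))%:E.
  by rewrite probability_setC// EFinB fineK.
have null B : measurable B -> ~ B a -> ~ B b -> mu B = 0%E.
  move=> mB Ba Bb; apply: dom => //.
  by rewrite hP// !indicE !memNset// !mulr0 addr0.
have DI (B C : set T) : measurable B -> measurable C ->
    mu B = (mu (B `\` C) + mu (B `&` C))%E.
  by move=> mB mC'; exact: (measureDI mu mB mC').
(* Within C, which contains at most the point x of the two, the mass of a set is
   that of C or 0 according to whether it contains x. *)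
have half (C : set T) x B : measurable C -> measurable B ->
    (C a -> x = a) -> (C b -> x = b) -> mu (B `&` C) = (mu C * (\1_B x)%:E)%E.
  move=> mCC mB Ca Cb.
  have [Bx|nBx] := pselect (B x).
    rewrite indicE mem_set// mule1 (DI _ _ mCC mB) setIC (null (C `\` B)) ?add0e//.
    - exact: measurableD.
    - by case=> /Ca <-.
    - by case=> /Cb <-.
  rewrite indicE memNset// mule0 null//.
  - exact: measurableI.
  - by case=> Ba /Ca e; apply: nBx; rewrite e.
  - by case=> Bb /Cb e; apply: nBx; rewrite e.
move=> B mB; rewrite (DI _ _ mB mA) setDE.
by rewrite (half A a)// (half (~` A) b)// muC addeC [in RHS]EFinD !EFinM fineK.
Qed.

Lemma dominates_two_point {mu P : probability T R} {m p} : 0 < p < 1 ->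
  two_point mu m -> two_point P p -> mu `<< P.
Proof.
move=> /andP[p0 p1] hmu hP; apply/dominatesP => B mB.
rewrite hP// hmu// => /eqP; rewrite eqe; move=> /eqP h; congr EFin.
have h1 : 0 <= \1_B a :> R by rewrite indicE; case: (_ \in _).
have h2 : 0 <= \1_B b :> R by rewrite indicE; case: (_ \in _).
have -> : \1_B a = 0 :> R by nra.
have -> : \1_B b = 0 :> R by nra.
by rewrite !mulr0 addr0.
Qed.

Lemma ge0_integral_two_point {P : probability T R} {p} {f : T -> \bar R} :
  0 <= p <= 1 -> two_point P p -> measurable_fun setT f ->
  (forall x, 0 <= f x)%E ->
  (\int[P]_x f x = p%:E * f a + (1 - p)%:E * f b)%E.
Proof.
move=> /andP[p0 p1] hP mf f0; have q0 : 0 <= 1 - p by rewrite subr_ge0.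
rewrite (eq_measure_integral (two_point_measure p0 q0)); last first.
  by move=> B mB _; exact: etrans (hP B mB) (esym (two_point_measureE p0 q0 B)).
rewrite ge0_integral_measure_add// !ge0_integral_mscale//.
by rewrite !integral_dirac// !diracT !mul1e.
Qed.

Lemma integral_two_point {P : probability T R} {p} {f : T -> \bar R} :
  0 <= p <= 1 -> two_point P p -> measurable_fun setT f ->
  (forall x, -oo < f x)%E ->
  (\int[P]_x f x = p%:E * f a + (1 - p)%:E * f b)%E.
Proof.
move=> p01 hP mf fNy; have /andP[p0 p1] := p01.
have q0 : 0 <= 1 - p by rewrite subr_ge0.
have fneg x : (f^\- x)%E \is a fin_num.
  rewrite ge0_fin_numE// funenegE maxEge; case: ifP => // _.
  by rewrite -lteNl.
rewrite integralE !(ge0_integral_two_point p01 hP)//; last 2 first.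
- exact: measurable_funeneg.
- exact: measurable_funepos.
have fE x : f x = (f^\+ x - f^\- x)%E by rewrite {1}(funeposneg f).
rewrite [in RHS](fE a) [in RHS](fE b).
move: (fneg a) (fneg b).
move: (f^\- a)%E (f^\- b)%E (f^\+ a)%E (f^\+ b)%E => na nb xa xb fa fb.
have pa : (p%:E * na)%E \is a fin_num by rewrite fin_numM.
have pb : ((1 - p)%:E * nb)%E \is a fin_num by rewrite fin_numM.
rewrite !muleBr// ?fin_num_adde_defl ?fin_numN//.
by rewrite addeACA fin_num_oppeD.
Qed.

End two_point.

(** * Conditioning two-point measures *)

Section density.
Context {d : measure_display} {T : measurableType d} {R : realType}.

Lemma density_fin_num {mu P : probability T R} y : mu `<< P ->
  density mu P y \is a fin_num.
Proof. by move=> dom; rewrite /density; apply: Radon_Nikodym_fin_num. Qed.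

Lemma measurable_density {mu P : probability T R} : mu `<< P ->
  measurable_fun setT (density mu P).
Proof.
move=> dom; rewrite /density.
by apply: (measurable_int P); apply: Radon_Nikodym_integrable.
Qed.

Lemma density_integral {mu P : probability T R} {B} : mu `<< P ->
  measurable B -> (\int[P]_(y in B) density mu P y = mu B)%E.
Proof.
move=> dom mB; rewrite /density.
by rewrite -(@Radon_Nikodym_integral _ _ _ (charge_of_finite_measure mu) P B dom mB).
Qed.

End density.

Section bridge.
Context {d : measure_display} {T : measurableType d} {R : realType}.
Context {a b : T} {A : set T}.
Hypothesis mA : measurable A.
Hypothesis Aa : A a.
Hypothesis Ab : ~ A b.
Context {g : R -> R}.
Hypothesis exs : forall x, posreals x -> exists s, subgrad posreals g x s.
Hypothesis g1 : g 1 = 0.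
Local Notation two_point := (two_point (a := a) (b := b)).

Lemma density_two_point {mu P : probability T R} {m p} :
  0 <= p <= 1 -> two_point mu m -> two_point P p -> mu `<< P ->
  p * fine (density mu P a) = m /\ (1 - p) * fine (density mu P b) = 1 - m.
Proof.
move=> p01 hmu hP dom.
have int (B : set T) : measurable B ->
    (mu B = p%:E * (density mu P a * (\1_B a)%:E) +
             (1 - p)%:E * (density mu P b * (\1_B b)%:E))%E.
  move=> mB; rewrite -(density_integral dom mB) integral_mkcond epatch_indic.
  apply: (integral_two_point p01 hP) => [|x].
    apply: emeasurable_funM; first exact: measurable_density.
    by apply/measurable_EFinP; exact: measurable_indic.
  by rewrite ltNye_eq fin_numM// density_fin_num.
split; apply: EFin_inj; rewrite EFinM fineK ?density_fin_num//.
  have := int A mA; rewrite (two_point_set mA Aa Ab hmu) !indicE (mem_set Aa).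
  by rewrite memNset// mule1 !mule0 adde0 => ->.
have mC := measurableC mA.
have nA : ~ (~` A) a by [].
have := int _ mC; rewrite (hmu _ mC) !indicE (memNset nA) mem_set//.
by rewrite mule1 !mule0 add0e mulr0 mulr1 add0r => ->.
Qed.

Lemma measurable_ext0_density (mu P : probability T R) : mu `<< P ->
  measurable_fun setT (fun y => ext0 g (fine (density mu P y))).
Proof.
move=> dom; apply: measurableT_comp; first exact: measurable_ext0.
by apply: measurableT_comp => //; exact: measurable_density.
Qed.

Lemma gdivergence_two_point {mu P : probability T R} {p} :
  0 <= p <= 1 -> two_point P p -> mu `<< P ->
  gdivergence g mu P = (p%:E * ext0 g (fine (density mu P a)) +
     (1 - p)%:E * ext0 g (fine (density mu P b)))%E.
Proof.
move=> p01 hP dom; apply: integral_two_point => //.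
  exact: measurable_ext0_density.
by move=> x; exact: ext0_gtNy.
Qed.

Lemma gdivergence_binary_div (mu P : probability T R) m p :
  0 < p < 1 -> two_point mu m -> two_point P p ->
  gdivergence g mu P = binary_div_ext g p m.
Proof.
move=> p01 hmu hP; have /andP[p0 p1] := p01.
have dom := dominates_two_point p01 hmu hP.
have p01' : 0 <= p <= 1 by rewrite !ltW.
have [h1 h2] := density_two_point p01' hmu hP dom.
rewrite (gdivergence_two_point p01' hP dom) /binary_div_ext -h2 -h1.
have e (u w : R) : 0 < u -> u * w / u = w by move=> u0; field; rewrite gt_eqF.
by rewrite !e// subr_gt0.
Qed.

Lemma gdivergence_dirac (mu P : probability T R) :
  two_point mu 0 -> two_point P 0 -> mu `<< P -> gdivergence g mu P = 0%E.
Proof.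
move=> hmu hP dom; have p01 : 0 <= (0 : R) <= 1 by rewrite lexx ler01.
have [_] := density_two_point p01 hmu hP dom.
rewrite !subr0 mul1r => e.
by rewrite (gdivergence_two_point p01 hP dom) subr0 e (ext0_pos g 1)// g1 mul0e mule0 adde0.
Qed.

Definition indic_loss (h : R) (y : T) : \bar R := (h * \1_A y)%:E.

Lemma loss_indic h : loss_function (indic_loss h).
Proof.
split; last by move=> y; exact: ltNyr.
by apply/measurable_EFinP; apply: measurable_funM.
Qed.

Lemma indic_lossD h h' :
  (fun y => indic_loss h y + indic_loss h' y)%E = indic_loss (h + h').
Proof. by apply/funext => y; rewrite /indic_loss mulrDl EFinD. Qed.

Lemma integral_indic_loss (mu : probability T R) m h :
  0 <= m <= 1 -> two_point mu m -> (\int[mu]_y indic_loss h y = (h * m)%:E)%E.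
Proof.
move=> m01 hmu.
rewrite (integral_two_point m01 hmu).
- rewrite /indic_loss !indicE (mem_set Aa) memNset// -!EFinM -EFinD.
  by rewrite mulr1 mulr0 mulr0 addr0 mulrC.
- exact: (loss_indic h).1.
- exact: (loss_indic h).2.
Qed.

(** All the integrals involved are finite, so no undefined difference occurs. *)
Lemma indic_loss_defined P (mu : probability T R) m h :
  0 <= m <= 1 -> two_point mu m ->
  cumulative_loss_defined g P (indic_loss h) mu.
Proof.
move=> m01 hmu; apply/andP; split; last first.
  by rewrite (integral_indic_loss mu m) // fin_num_adde_defr.
have [mh _] := loss_indic h.
rewrite !(ge0_integral_two_point m01 hmu)//; last 2 first.
- exact: measurable_funeneg.
- exact: measurable_funepos.
apply: fin_num_adde_defl; rewrite fin_numN fin_numD !fin_numM//.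
all: by rewrite funenegE /indic_loss -EFinN -EFin_max.
Qed.

Lemma cumulative_loss_binary_div (mu P : probability T R) m p h :
  0 < p < 1 -> 0 <= m <= 1 -> two_point mu m -> two_point P p ->
  cumulative_loss g P (indic_loss h) mu = (binary_div_ext g p m + (h * m)%:E)%E.
Proof.
move=> p01 m01 hmu hP.
by rewrite /cumulative_loss (integral_indic_loss _ m)// (gdivergence_binary_div _ _ m p)// addeC.
Qed.

(** Every competitor is dominated by [P], hence a two-point measure, and its
    cumulative loss depends only on its mass on [A]. *)
Lemma strict_min_conditional (P Q : probability T R) p l h :
  0 < p < 1 -> two_point P p -> two_point Q l -> strict_min g p h l ->
  conditional_distribution g P (indic_loss h) Q.
Proof.
move=> p01 hP hQ [l01 hl].
have p01' : 0 <= p <= 1 by case/andP: p01 => ? ?; rewrite !ltW.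
have admQ : admissible g P (indic_loss h) Q.
  by split; [exact: (dominates_two_point p01 hQ hP)|exact: (indic_loss_defined _ _ l)].
have lossQ := cumulative_loss_binary_div Q P l p h p01 l01 hQ hP.
split.
  split=> // nu [/(two_point_dominated mA Aa Ab hP)[m m01 hnu] _].
  rewrite lossQ (cumulative_loss_binary_div nu P m p)//.
  by have [->//|mNl] := eqVneq m l; apply: ltW; exact: hl.
move=> mu [[/(two_point_dominated mA Aa Ab hP)[m m01 hmu] _] mumin].
suff ml : m = l by rewrite ml in hmu; exact: (two_point_eq hmu hQ).
apply/eqP; apply: contraT => /(hl _ m01); rewrite ltNge => /negP; case.
by have := mumin Q admQ; rewrite lossQ (cumulative_loss_binary_div mu P m p).
Qed.

(** A measure dominated by a Dirac mass is equal to it, whatever the loss. *)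
Lemma dirac_conditional (P : probability T R) h : two_point P 0 ->
  conditional_distribution g P (indic_loss h) P.
Proof.
move=> hP; have O01 : 0 <= (0 : R) <= 1 by rewrite lexx ler01.
have P0 : P A = 0%E by rewrite (two_point_set mA Aa Ab hP).
have all0 (nu : probability T R) : nu `<< P -> two_point nu 0.
  move=> dom; have [m m01 hnu] := two_point_dominated mA Aa Ab hP dom.
  have := (dominatesP _ _).1 dom A mA P0.
  by rewrite (two_point_set mA Aa Ab hnu) => -[m0]; rewrite m0 in hnu.
have loss0 (nu : probability T R) : nu `<< P -> cumulative_loss g P (indic_loss h) nu = 0%E.
  move=> dom; rewrite /cumulative_loss (integral_indic_loss _ 0)//; last exact: all0.
  by rewrite mulr0 add0e gdivergence_dirac//; exact: all0.
have PP : P `<< P by apply/dominatesP.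
split.
  split; first by split=> //; exact: (indic_loss_defined _ _ 0).
  by move=> nu [dom _]; rewrite !loss0.
by move=> mu [[dom _] _]; exact: two_point_eq (all0 _ dom) hP.
Qed.

Hypothesis coherence : forall (P : probability T R) (hI hJ : T -> \bar R)
    (Pbar PIJ PbarJ : probability T R),
  loss_function hI -> loss_function hJ ->
  conditional_distribution g P hI Pbar ->
  conditional_distribution g P (fun y => hI y + hJ y)%E PIJ ->
  conditional_distribution g Pbar hJ PbarJ ->
  measure_eq PIJ PbarJ.

Lemma coherence_at_0 : coherent_at_0 g.
Proof.
move=> p h h' m p01 min1 min2; have /andP[p0 p1] := p01.
have [P hP] : exists P, two_point P p by apply: ex_two_point; rewrite !ltW.
have [Q hQ] : exists Q, two_point Q _ := ex_two_point min1.1.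
have [Q' hQ'] : exists Q', two_point Q' _ := ex_two_point min2.1.
have c1 := strict_min_conditional _ _ _ _ _ p01 hP hQ min1.
have c2 := strict_min_conditional _ _ _ _ _ p01 hP hQ' min2.
have c3 := dirac_conditional Q h' hQ.
rewrite -(indic_lossD h h') in c2.
have e : Q' A = Q A :=
  coherence _ _ _ _ _ _ (loss_indic h) (loss_indic h') c1 c2 c3 A mA.
by move: e; rewrite (two_point_set mA Aa Ab hQ) (two_point_set mA Aa Ab hQ') => -[].
Qed.

Lemma coherence_inside : coherent_inside g.
Proof.
move=> p l h h' m m' p01 l01 min1 min2 min3; have /andP[p0 p1] := p01.
have [P hP] : exists P, two_point P p by apply: ex_two_point; rewrite !ltW.
have [Q hQ] : exists Q, two_point Q _ := ex_two_point min1.1.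
have [Q2 hQ2] : exists Q2, two_point Q2 _ := ex_two_point min2.1.
have [Q3 hQ3] : exists Q3, two_point Q3 _ := ex_two_point min3.1.
have c1 := strict_min_conditional _ _ _ _ _ p01 hP hQ min1.
have c2 := strict_min_conditional _ _ _ _ _ l01 hQ hQ2 min2.
have c3 := strict_min_conditional _ _ _ _ _ p01 hP hQ3 min3.
rewrite -(indic_lossD h h') in c3.
have e : Q3 A = Q2 A :=
  coherence _ _ _ _ _ _ (loss_indic h) (loss_indic h') c1 c3 c2 A mA.
by move: e; rewrite (two_point_set mA Aa Ab hQ2) (two_point_set mA Aa Ab hQ3) => -[].
Qed.

End bridge.

(** * The identity for arbitrary measures *)

Lemma measurable_lne_EFin {R : realType} :
  measurable_fun [set: R] (fun r => lne r%:E).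
Proof.
apply: measurable_fun_if => //.
- exact: measurable_fun_ler.
- by apply/measurable_EFinP; apply: measurable_funTS.
Qed.

(** At 0 the upper bound comes from [x * ln x <= 0] near 0 and the lower bound from
    the value at 0 of the supporting lines at small [x]. *)
Lemma ext0_klfun {R : realType} {g : R -> R} {k c : R} : 0 < k ->
  (forall x, posreals x -> exists s, subgrad posreals g x s) ->
  (forall x, 0 < x -> g x = klfun k c x) ->
  forall r, 0 <= r -> ext0 g r = (klfun k c r)%:E.
Proof.
move=> k0 exs gE r; rewrite le_eqVlt => /predU1P[<-|r0]; last first.
  by rewrite ext0_pos// gE.
have -> : klfun k c 0 = k - c by rewrite /klfun; ring.
have sg x : 0 < x -> subgrad posreals g x (c + k * ln x).
  move=> x0; have [_ h] := subgrad_klfun (c := c) k0 x x0.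
  by split=> // y y0; rewrite !gE//; exact: h.
have e2 (e : R) : 0 < e -> 0 < e / (`|c| + k).
  by move=> e0; rewrite divr_gt0// ltr_wpDl.
have ck : 0 < `|c| + k by rewrite ltr_wpDl.
apply/eqP; rewrite eq_le; apply/andP; split.
- rewrite /ext0 ltxx; apply/lee_addgt0Pr => e e0.
  apply: lime_le; first exact: is_cvg_at_0.
  near=> x.
  have x0 : 0 < x by near: x; exact: nbhs_right_gt.
  have x1 : x < 1 by near: x; exact: nbhs_right_lt.
  have xe : x < e / (`|c| + k) by near: x; apply: nbhs_right_lt; exact: e2.
  rewrite ltr_pdivlMr// in xe.
  rewrite -EFinD lee_fin gE// /klfun.
  have lx : ln x <= 0 by apply: ln_le0; exact: ltW.
  have xl : 0 <= x * - ln x by apply: mulr_ge0 (ltW x0) _; rewrite oppr_ge0.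
  have kxl := mulr_ge0 (ltW k0) xl.
  have kx : 0 < k * x by rewrite mulr_gt0.
  have cx : c * x <= `|c| * x by rewrite ler_pM2r// ler_norm.
  nra.
- apply/lee_subgt0Pr => e e0.
  pose x := e / (`|c| + k).
  have x0 : 0 < x := e2 e e0.
  have xe : x * (`|c| + k) = e by rewrite /x; field; rewrite gt_eqF.
  apply: le_trans (ext0_ge exs (sg x x0) (lexx 0)).
  rewrite -EFinB lee_fin gE// /klfun.
  have := mulr_ge0 (normr_ge0 c) (ltW x0).
  nra.
Unshelve. all: by end_near.
Qed.

(** Additivity when the nonnegative term may have an infinite integral: then the sum
    has a finite negative part, bounded by [`|B|], and an infinite positive part. *)
Lemma ge0_integralD_integrable {d} {T : measurableType d} {R : realType}
    (P : {measure set T -> \bar R}) (F B : T -> \bar R) :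
  measurable_fun setT F -> (forall x, 0 <= F x)%E -> P.-integrable setT B ->
  (\int[P]_x (F x + B x) = \int[P]_x F x + \int[P]_x B x)%E.
Proof.
move=> mF F0 iB; have mB := measurable_int _ iB.
have mD : measurable_fun setT (F \+ B) by exact: emeasurable_funD.
have [Foo|] := ltP (\int[P]_x F x)%E +oo%E.
  rewrite integralD//; apply/integrableP; split => //.
  by under eq_integral do rewrite gee0_abs//.
rewrite leye_eq => /eqP Foo; rewrite Foo.
have fB : (\int[P]_x B x)%E \is a fin_num by exact: integrable_fin_num.
rewrite addye; last by move: fB; rewrite fin_numE => /andP[].
have /integrableP[_ aB] := iB.
have maB : measurable_fun setT (fun x => `|B x|)%E by exact: measurableT_comp.
rewrite integralE.
have negoo : (\int[P]_x ((F \+ B)^\- x) < +oo)%E.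
  apply: le_lt_trans aB; apply: ge0_le_integral => //; first exact: measurable_funeneg.
  move=> x _; rewrite funenegE ge_max abse_ge0 andbT /=.
  have := F0 x; case: (F x) => [r| |]; case: (B x) => [s| |]//=; rewrite ?leNye// ?lee_fin => r0.
  by have := ler_norm (- s); rewrite normrN; lra.
have -> : (\int[P]_x ((F \+ B)^\+ x) = +oo)%E.
  apply/eqP; rewrite -leye_eq leNgt; apply/negP => posoo.
  suff : (\int[P]_x F x < +oo)%E by rewrite Foo.
  apply: le_lt_trans (lte_add_pinfty posoo aB).
  rewrite -ge0_integralD//; last exact: measurable_funepos.
  apply: ge0_le_integral => //.
    by apply: emeasurable_funD => //; exact: measurable_funepos.
  move=> x _; rewrite funeposE /=.
  have FNy : F x != -oo%E by rewrite gt_eqF// (lt_le_trans _ (F0 x)).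
  have maxNy : maxe (F x + B x)%E 0%E != -oo%E.
    by rewrite gt_eqF// lt_max ltNy0 orbT.
  move: maxNy; case: (B x) => [s| |] maxNy /=; rewrite ?addey ?leey ?FNy//.
  apply: (@le_trans _ _ (F x + s%:E + `|s|%:E)%E); last first.
    by apply: leeD => //; rewrite le_max lexx.
  have := F0 x; case: (F x) => [r| |]//= r0.
  by rewrite !lee_fin; have := ler_norm (- s); rewrite normrN; lra.
by rewrite addye// eqe_oppLR /= lt_eqF.
Qed.

Section KL_identity.
Context {d : measure_display} {T : measurableType d} {R : realType}.
Context {Q P : probability T R}.
Hypothesis dom : Q `<< P.

Let F := Radon_Nikodym_SigmaFinite.f Q P.
Let f y := fine (F y).

Let F_f y : F y = (f y)%:E.
Proof. by rewrite /f fineK// /F; exact: Radon_Nikodym_SigmaFinite.f_fin_num. Qed.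

Let f_ge0 y : 0 <= f y.
Proof. by rewrite fine_ge0// /F; exact: Radon_Nikodym_SigmaFinite.f_ge0. Qed.

Let iF : P.-integrable setT F.
Proof. exact: Radon_Nikodym_SigmaFinite.f_integrable. Qed.

Let mf : measurable_fun setT f.
Proof. by apply: measurableT_comp => //; exact: measurable_int iF. Qed.

(** The density obtained from a signed measure need not be nonnegative everywhere;
    this version is, which gives the change of variables for all nonnegative
    integrands, integrable or not. *)
Lemma ex_nonneg_density : exists2 f : T -> R,
  [/\ measurable_fun setT f, forall y, 0 <= f y,
      P.-integrable setT (EFin \o f) & (\int[P]_y (f y)%:E = 1)%E] &
  ae_eq P setT (density Q P) (EFin \o f) /\
  forall h : T -> \bar R, (forall x, 0 <= h x)%E -> measurable_fun setT h ->
    (\int[Q]_x h x = \int[P]_x (h x * (f x)%:E))%E.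
Proof.
have FE : F = EFin \o f by apply/funext => y; exact: F_f.
exists f; split=> //.
- by rewrite -FE.
- rewrite -(probability_setT Q) (Radon_Nikodym_SigmaFinite.f_integral dom measurableT).
  by apply: eq_integral => y _; rewrite -F_f.
- rewrite -FE; apply: ae_eq_sym.
  exact: (ae_eq_Radon_Nikodym_SigmaFinite dom measurableT).
- move=> h h0 mh.
  rewrite -(Radon_Nikodym_SigmaFinite.change_of_variables dom h0 measurableT mh).
  by apply: eq_integral => y _; rewrite -F_f.
Qed.

End KL_identity.

Section identity.
Context {d : measure_display} {T : measurableType d} {R : realType}.
Context {Q P : probability T R}.
Hypothesis dom : Q `<< P.

Lemma integral_ae_density (h : \bar R -> \bar R) (f : T -> R)
    (mu : probability T R) : mu `<< P ->
  measurable_fun setT (fun y => h (density Q P y)) ->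
  measurable_fun setT (fun y => h (f y)%:E) ->
  ae_eq P setT (density Q P) (EFin \o f) ->
  (\int[mu]_y h (density Q P y) = \int[mu]_y h (f y)%:E)%E.
Proof.
move=> muP m1 m2 ae; apply: ae_eq_integral => //.
apply: (null_dominates_ae_eq measurableT muP).
by move: ae; apply: filterS => y /= /(_ I) -> _.
Qed.

Lemma x_ln_x_ge (x : R) : 0 <= x -> x - 1 <= x * ln x.
Proof.
rewrite le_eqVlt => /predU1P[<-|x0]; first by rewrite mul0r; lra.
have ix0 : 0 < x^-1 by rewrite invr_gt0.
have := ln_le_sub1 _ ix0; rewrite lnV ?posrE// => h.
have xx : x * x^-1 = 1 by rewrite divff// gt_eqF.
have := ler_wpM2l (ltW x0) h; lra.
Qed.

(** With [f] the density and both integrals taken against [P], the integrands are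
    positive multiples of the nonnegative [A = f ln f - (f - 1)] plus multiples of
    [B = f - 1], which is integrable with integral 0. *)
Lemma gdivergence_klfun (g : R -> R) (k c : R) : 0 < k ->
  (forall x, posreals x -> exists s, subgrad posreals g x s) ->
  (forall x, 0 < x -> g x = klfun k c x) ->
  gdivergence g Q P = (k%:E * KL Q P)%E.
Proof.
move=> k0 exs gE.
have [f [mf f0 iF int1] [ae cov]] := ex_nonneg_density dom.
have mdens := measurable_density dom.
have dens_fin y : density Q P y = (fine (density Q P y))%:E.
  by rewrite fineK// density_fin_num.
pose A y := (f y * ln (f y) - (f y - 1))%:E.
pose B y := (f y - 1)%:E.
have A0 y : (0 <= A y)%E by rewrite lee_fin subr_ge0 x_ln_x_ge.
have mB1 : measurable_fun setT (fun y => f y - 1) by exact: measurable_funB.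
have mln : measurable_fun setT (fun y => ln (f y)).
  by apply: measurableT_comp.
have mfl : measurable_fun setT (fun y => f y * ln (f y)) by exact: measurable_funM.
have mA : measurable_fun setT A.
  by apply/measurable_EFinP; exact: measurable_funB.
have iB : P.-integrable setT B.
  have := integrableB measurableT iF (finite_measure_integrable_cst P 1 measurableT).
  by apply: eq_integrable => // y _; rewrite /B EFinB.
have B1 : (\int[P]_y B y = 0)%E.
  rewrite /B; under eq_integral do rewrite EFinB.
  rewrite integralB//; last exact: (finite_measure_integrable_cst P 1 measurableT).
  by rewrite int1 integral_cst// mul1e [X in (_ - X)%E]probability_setT subee.
have -> : gdivergence g Q P = (k%:E * \int[P]_y A y)%E.
  rewrite /gdivergence.
  have PP : P `<< P by apply/dominatesP.
  rewrite (integral_ae_density (fun z => ext0 g (fine z)) f P PP)//; last 2 first.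
  - exact: measurable_ext0_density.
  - apply: (measurableT_comp (f := ext0 g)) => //; exact: measurable_ext0.
  under eq_integral => y _.
    rewrite /= (ext0_klfun k0 exs gE)//.
    rewrite (_ : klfun k c (f y) = k * (f y * ln (f y) - (f y - 1)) + c * (f y - 1)); last first.
      by rewrite /klfun; ring.
    rewrite EFinD !EFinM -/(A y) -/(B y); over.
  rewrite /= ge0_integralD_integrable//.
  - rewrite ge0_integralZl_EFin//; last exact: ltW.
    by rewrite integralZl// B1 mule0 adde0.
  - exact: measurable_funeM.
  - by move=> y; rewrite mule_ge0// lee_fin ltW.
  - exact: integrableZl.
congr (_ * _)%E.
have mlne (h : T -> R) : measurable_fun setT h ->
    measurable_fun setT (fun y => lne (h y)%:E).
  by move=> mh; apply: (measurableT_comp (f := fun r => lne r%:E)) => //; exact: measurable_lne_EFin.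
rewrite /KL (integral_ae_density (@lne R) f Q dom)//; last 2 first.
- rewrite (_ : (fun y => _) = (fun y => lne (fine (density Q P y))%:E)).
    by apply: mlne; exact: measurableT_comp.
  by apply/funext => y; rewrite -dens_fin.
- exact: mlne.
pose psi y := (f y * ln (f y))%:E.
transitivity (\int[P]_y psi y)%E.
  rewrite -[LHS]adde0 -B1 -ge0_integralD_integrable//.
  by apply: eq_integral => y _; rewrite /A /B /psi -EFinD subrK.
rewrite [in RHS]integralE !cov//; last 2 first.
- by apply: measurable_funeneg; exact: mlne.
- by apply: measurable_funepos; exact: mlne.
rewrite [in LHS]integralE; congr (_ - _)%E; apply: eq_integral => y _.
- rewrite !funeposE /psi.
  have := f0 y; rewrite le_eqVlt => /predU1P[<-|fy].
    by rewrite mul0r mule0 maxxx.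
  rewrite lne_EFin// -!EFin_max -EFinM; congr EFin.
  by rewrite maxr_pMl ?(ltW fy)// mul0r mulrC.
- rewrite !funenegE /psi.
  have := f0 y; rewrite le_eqVlt => /predU1P[<-|fy].
    by rewrite mul0r mule0 oppe0 maxxx.
  rewrite lne_EFin// -!EFinN -!EFin_max -EFinM; congr EFin.
  by rewrite maxr_pMl ?(ltW fy)// mul0r mulNr mulrC.
Qed.

(** Measurable functions are constant, and a constant density is equal to 1. *)
Lemma trivial_sigma_algebra_divergence (g : R -> R) : g 1 = 0 ->
  (forall A : set T, measurable A -> forall a b, A a -> A b) ->
  gdivergence g Q P = KL Q P.
Proof.
move=> g1 triv.
have [x0 _] : exists x0 : T, True by exists point.
have mdens := measurable_density dom.
have dens_cst y : density Q P y = density Q P x0.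
  have mx : measurable (density Q P @^-1` [set density Q P x0]).
    by rewrite -[X in measurable X]setTI; apply: mdens.
  exact: (triv _ mx x0 y).
have dens1 y : density Q P y = 1%E.
  have := density_integral dom measurableT.
  under eq_integral => z _ do rewrite dens_cst.
  by rewrite integral_cst//= !probability_setT mule1 dens_cst.
rewrite /gdivergence /KL.
under eq_integral do rewrite dens1 /= ext0_pos// g1.
under [in RHS]eq_integral do rewrite dens1 lne1.
by rewrite !integral0.
Qed.

End identity.

Theorem mainTheorem1 (d : measure_display) (T : measurableType d)
    (R : realType) (g : R -> R)
    (convex_g : convex_function (`]0, +oo[ : set R) g)
    (g1 : g 1 = 0)
    (coherence : forall (P : probability T R) (hI hJ : T -> \bar R)
        (Pbar PIJ PbarJ : probability T R),
      loss_function hI -> loss_function hJ ->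
      conditional_distribution g P hI Pbar ->
      conditional_distribution g P (fun y => hI y + hJ y)%E PIJ ->
      conditional_distribution g Pbar hJ PbarJ ->
      measure_eq PIJ PbarJ) :
  exists2 k : R, 0 < k &
    forall Q1 Q2 : probability T R, Q1 `<< Q2 ->
      gdivergence g Q1 Q2 = (k%:E * KL Q1 Q2)%E.
Proof.
have [[A [a [b [mA Aa Ab]]]]|triv] := pselect (exists A : set T,
    exists a b, [/\ measurable A, A a & ~ A b]); last first.
  exists 1 => // Q1 Q2 dom; rewrite mul1e.
  apply: trivial_sigma_algebra_divergence => // A mA a b Aa.
  by apply: contrapT => Ab; apply: triv; exists A, a, b.
have exs := convex_ex_subgrad g convex_g.
have coh0 := coherence_at_0 mA Aa Ab exs g1 coherence.
have coh1 := coherence_inside mA Aa Ab exs coherence.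
have [k [c [k0 gE]]] := coherent_convex_klfun convex_g g1 coh0 coh1.
by exists k => // Q1 Q2 dom; exact: gdivergence_klfun k0 exs gE.
Qed.
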